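(* Let $H$ be a finite-dimensional Hopf algebra over a field $k$. Then every exact left $H$-comodule algebra is a Frobenius algebra.
   Context: A left $H$-comodule algebra is an (associative unital) $k$-algebra $L$ equipped with a left $H$-comodule structure $L\to H\otimes L$, $a\mapsto a_{(-1)}\otimes a_{(0)}$, that is an algebra map. If $L$ is finite-dimensional, the tensor category ${}_H\mathfrak M$ of finite-dimensional left $H$-modules acts on the category ${}_L\mathfrak M$ of finite-dimensional left $L$-modules by $X\triangleright M=X\otimes M$ with $a(x\otimes m)=a_{(-1)}x\otimes a_{(0)}m$. An exact left $H$-comodule algebra is a finite-dimensional left $H$-comodule algebra $L$ such that ${}_L\mathfrak M$ is an exact module category over ${}_H\mathfrak M$, i.e. $P\triangleright M$ is projective in ${}_L\mathfrak M$ for every projective $P\in{}_H\mathfrak M$ and every $M\in{}_L\mathfrak M$. A finite-dimensional algebra $L$ is a Frobenius algebra if there is a linear form $\lambda:L\to k$ such that the map $L\to L^*$, $a\mapsto\lambda(a\,\cdot\,)$, is bijective. *)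

(* Defs.v *)
From HB Require Import structures.
From mathcomp Require Import all_boot all_order all_algebra.

Set Implicit Arguments.
Unset Strict Implicit.
Unset Printing Implicit Defensive.

Import GRing.Theory VectorInternalTheory.
Local Open Scope ring_scope.

Reserved Notation "v \ox w" (at level 40, left associativity).

(* Finite-dimensional unital associative algebras. The algebra structures of  *)
(* the library (algType, falgType) require 1 != 0; the zero algebra is        *)
(* allowed here, which is why the product is not inherited from them. The     *)
(* ring structure of A is made canonical below.                               *)
HB.mixin Record Vector_isFinAlgebra (K : fieldType) A of Vector K A := {
  fmul : A -> A -> A;
  fone : A;
  fmulA : associative fmul;
  fmul1l : left_id fone fmul;
  fmul1r : right_id fone fmul;
  fmulDl : left_distributive fmul +%R;
  fmulDr : right_distributive fmul +%R;
  fmulZl : forall (c : K) (a b : A), fmul (c *: a) b = c *: fmul a b;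
  fmulZr : forall (c : K) (a b : A), fmul a (c *: b) = c *: fmul a b
}.

#[short(type="finAlgType")]
HB.structure Definition FinAlgebra (K : fieldType) :=
  {A of Vector K A & Vector_isFinAlgebra K A}.

HB.instance Definition _ (K : fieldType) (A : finAlgType K) :=
  GRing.Zmodule_isPzRing.Build (FinAlgebra.sort A)
    fmulA fmul1l fmul1r fmulDl fmulDr.

Lemma fscalerAl (K : fieldType) (A : finAlgType K) (c : K) (a b : A) :
  c *: (a * b) = (c *: a) * b.
Proof. exact/esym/fmulZl. Qed.

Lemma fscalerAr (K : fieldType) (A : finAlgType K) (c : K) (a b : A) :
  c *: (a * b) = a * (c *: b).
Proof. exact/esym/fmulZr. Qed.

(* V (x) W is realized as the space of matrices of coordinates with respect   *)
(* to the bases e_i of V and f_j of W underlying their vectType structures;   *)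
(* the pure tensor v \ox w is the outer product.                              *)
Definition tensor (K : fieldType) (V W : vectType K) : Type :=
  'M[K]_(dim V, dim W).

HB.instance Definition _ (K : fieldType) (V W : vectType K) :=
  Vector.copy (tensor V W) 'M[K]_(dim V, dim W).

Section Tensor.
Variables (K : fieldType).
Implicit Types U V W : vectType K.

Definition tpure V W (v : V) (w : W) : tensor V W := (v2r v)^T *m v2r w.

Definition bilinear_map V W U (b : V -> W -> U) : Prop :=
  (forall w, linear (b^~ w)) /\ (forall v, linear (b v)).

Definition tbasis V (i : 'I_(dim V)) : V := r2v (delta_mx 0 i).

(* The linear map with e_i \ox f_j |-> b e_i f_j; for bilinear b it is        *)
(* the map v \ox w |-> b v w of the universal property, cf. tliftE.           *)
Definition tlift V W U (b : V -> W -> U) : 'Hom(tensor V W, U) :=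
  linfun (fun t : tensor V W =>
    \sum_i \sum_j (t : 'M[K]_(_, _)) i j *: b (tbasis i) (tbasis j)).

Lemma tlift_linear V W U (b : V -> W -> U) :
  linear (fun t : tensor V W =>
    \sum_i \sum_j (t : 'M[K]_(_, _)) i j *: b (tbasis i) (tbasis j)).
Proof.
move=> c s t; rewrite scaler_sumr -big_split; apply: eq_bigr => i _ /=.
rewrite scaler_sumr -big_split; apply: eq_bigr => j _ /=.
by rewrite !mxE scalerDl scalerA.
Qed.

Lemma linfunE V W (f : V -> W) : linear f -> linfun f =1 f.
Proof.
move=> lf; pose F := GRing.isLinear.Build K V W _ f lf.
pose g : {linear V -> W} := HB.pack f F.
exact: (lfunE g).
Qed.

Lemma tlift_coordE V W U (b : V -> W -> U) t :
  tlift b t = \sum_i \sum_j (t : 'M[K]_(_, _)) i j *: b (tbasis i) (tbasis j).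
Proof. by rewrite linfunE //; apply: tlift_linear. Qed.

Lemma tbasis_sum V (v : V) : v = \sum_i v2r v 0 i *: tbasis i.
Proof.
apply: (can_inj v2rK); rewrite linear_sum {1}[v2r v]row_sum_delta.
by apply: eq_bigr => i _; rewrite linearZ /= r2vK.
Qed.

Lemma linear_fun_sum V W (f : V -> W) (I : finType) (c : I -> K) (e : I -> V) :
  linear f -> f (\sum_i c i *: e i) = \sum_i c i *: f (e i).
Proof.
move=> lf; rewrite -(linfunE lf) linear_sum; apply: eq_bigr => i _.
by rewrite linearZ /= (linfunE lf).
Qed.

Lemma tpure_bilinear V W : bilinear_map (@tpure V W).
Proof.
split=> [w c v v' | v c w w']; rewrite /tpure.
- by rewrite !linearP /= mulmxDl -scalemxAl.
- by rewrite !linearP.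
Qed.

Lemma tpure_coordE V W (v : V) (w : W) i j :
  (tpure v w : 'M[K]_(_, _)) i j = v2r v 0 i * v2r w 0 j.
Proof. by rewrite !mxE big_ord1 !mxE. Qed.

Lemma tliftE V W U (b : V -> W -> U) v w :
  bilinear_map b -> tlift b (tpure v w) = b v w.
Proof.
case=> bl br; rewrite tlift_coordE {2}[v]tbasis_sum {2}[w]tbasis_sum.
rewrite (linear_fun_sum _ _ (bl _)); apply: eq_bigr => i _.
rewrite (linear_fun_sum _ _ (br _)) scaler_sumr; apply: eq_bigr => j _.
by rewrite tpure_coordE scalerA.
Qed.

Lemma tensor_ind V W (P : tensor V W -> Prop) :
    (forall s t, P s -> P t -> P (s + t)) ->
    (forall v w, P (tpure v w)) -> forall t, P t.
Proof.
move=> PD Pp t.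
have P0 : P 0.
  have -> : 0 = tpure (0 : V) (0 : W) by rewrite /tpure !linear0.
  exact: Pp.
have -> : t = \sum_i \sum_j
    tpure ((t : 'M[K]_(_, _)) i j *: tbasis i : V) (tbasis j : W).
  apply/matrixP=> i j; rewrite summxE (bigD1 i) //= summxE (bigD1 j) //=.
  rewrite tpure_coordE linearZ /= !r2vK !mxE !eqxx !mulr1.
  rewrite big1 ?addr0 => [|j' /negPf nj].
    rewrite big1 ?addr0 // => i' /negPf ni.
    rewrite summxE big1 // => j' _.
    by rewrite tpure_coordE linearZ /= !r2vK !mxE /= [i == _]eq_sym ni mulr0 mul0r.
  by rewrite tpure_coordE !r2vK !mxE /= [j == _]eq_sym nj mulr0.
by elim/big_ind: _ => // i _; elim/big_ind: _ => // j _; apply: Pp.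
Qed.

Lemma tensor_lfunP V W U (f g : 'Hom(tensor V W, U)) :
  (forall v w, f (tpure v w) = g (tpure v w)) -> f = g.
Proof.
move=> fg; apply/lfunP; apply: tensor_ind => // s t es et.
by rewrite !linearD /= es et.
Qed.

Definition tmap V W V' W' (f : 'Hom(V, V')) (g : 'Hom(W, W')) :
    'Hom(tensor V W, tensor V' W') :=
  tlift (fun v w => tpure (f v) (g w)).

Lemma tmapE V W V' W' (f : 'Hom(V, V')) (g : 'Hom(W, W')) v w :
  tmap f g (tpure v w) = tpure (f v) (g w).
Proof.
have [bl br] := @tpure_bilinear V' W'.
by rewrite tliftE //; split=> [w'|v'] c x y; rewrite linearP ?bl ?br.
Qed.

Lemma tmap_bilinear V W V' W' :
  bilinear_map (fun (f : 'Hom(V, V')) (g : 'Hom(W, W')) => tmap f g).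
Proof.
have [bl br] := @tpure_bilinear V' W'.
by split=> [g | f] c x y; apply: tensor_lfunP => v w;
  rewrite !(tmapE, add_lfunE, scale_lfunE) (bl, br).
Qed.

Definition tassoc U V W :
    'Hom(tensor (tensor U V) W, tensor U (tensor V W)) :=
  tlift (fun (s : tensor U V) (w : W) =>
    tlift (fun u v => tpure u (tpure v w)) s).

Lemma tassocE U V W (u : U) (v : V) (w : W) :
  tassoc U V W (tpure (tpure u v) w) = tpure u (tpure v w).
Proof.
have [bl br] := @tpure_bilinear V W.
have [Bl Br] := @tpure_bilinear U (tensor V W).
have bb (w' : W) : bilinear_map (fun (x : U) (y : V) => tpure x (tpure y w')).
  split=> [y | x] c z z' /=; first by rewrite Bl.
  by rewrite bl Br.
rewrite tliftE ?tliftE //; split=> [w' | s] c x y; first by rewrite linearP.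
elim/tensor_ind: s => [s t es et | x' y'].
  by rewrite !linearD /= es et addrACA.
by rewrite !tliftE // br Br.
Qed.

End Tensor.

Notation "v \ox w" := (tpure v w) : ring_scope.

(* The algebra structure (a \ox b) * (a' \ox b') = (a * a') \ox (b * b') on   *)
(* the tensor product of two algebras.                                        *)
Section TensorAlgebra.
Variables (K : fieldType) (A B : finAlgType K).
Local Notation T := (tensor A B).

Definition tone : T := (1 : A) \ox (1 : B).

Definition tmul (s t : T) : T :=
  tlift (fun (a : A) (b : B) =>
    tlift (fun (a' : A) (b' : B) => (a * a') \ox (b * b'))) s t.

Let tmul_inner (a : A) (b : B) :
  bilinear_map (fun (a' : A) (b' : B) => (a * a') \ox (b * b')).
Proof.
have [bl br] := @tpure_bilinear K A B.
by split=> [b' | a'] c x y; rewrite mulrDr -fscalerAr ?bl ?br.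
Qed.

Let tmul_outer : bilinear_map (fun (a : A) (b : B) =>
  tlift (fun (a' : A) (b' : B) => (a * a') \ox (b * b'))).
Proof.
have [bl br] := @tpure_bilinear K A B.
split=> [b | a] c x y; apply: tensor_lfunP => a' b';
  by rewrite add_lfunE scale_lfunE !tliftE // mulrDl -fscalerAl ?bl ?br.
Qed.

Lemma tmulE a b a' b' : tmul (a \ox b) (a' \ox b') = (a * a') \ox (b * b').
Proof. by rewrite /tmul tliftE // tliftE. Qed.

Lemma tmulDl : left_distributive tmul +%R.
Proof. by move=> s s' t; rewrite /tmul linearD add_lfunE. Qed.

Lemma tmulDr : right_distributive tmul +%R.
Proof. by move=> s t t'; rewrite /tmul linearD. Qed.

Lemma tmulA : associative tmul.
Proof.
elim/tensor_ind=> [s s' es es' t u | a b]; first by rewrite !tmulDl es es'.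
elim/tensor_ind=> [t t' et et' u | a' b'].
  by rewrite tmulDl !tmulDr tmulDl et et'.
elim/tensor_ind=> [u u' eu eu' | a'' b'']; first by rewrite !tmulDr eu eu'.
by rewrite !tmulE !mulrA.
Qed.

Lemma tmul1l : left_id tone tmul.
Proof.
elim/tensor_ind=> [s t es et | a b]; first by rewrite tmulDr es et.
by rewrite tmulE !mul1r.
Qed.

Lemma tmul1r : right_id tone tmul.
Proof.
elim/tensor_ind=> [s t es et | a b]; first by rewrite tmulDl es et.
by rewrite tmulE !mulr1.
Qed.

Lemma tmulZl (c : K) (s t : T) : tmul (c *: s) t = c *: tmul s t.
Proof. by rewrite /tmul linearZ /= scale_lfunE. Qed.

Lemma tmulZr (c : K) (s t : T) : tmul s (c *: t) = c *: tmul s t.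
Proof. by rewrite /tmul linearZ. Qed.

HB.instance Definition _ := Vector_isFinAlgebra.Build K T
  tmulA tmul1l tmul1r tmulDl tmulDr tmulZl tmulZr.
HB.instance Definition _ :=
  GRing.Zmodule_isPzRing.Build T tmulA tmul1l tmul1r tmulDl tmulDr.

Lemma tensor_oneE : 1 = (1 : A) \ox (1 : B) :> T.
Proof. by []. Qed.

Lemma tensor_mulE (a a' : A) (b b' : B) :
  (a \ox b) * (a' \ox b') = (a * a') \ox (b * b') :> T.
Proof. exact: tmulE. Qed.

End TensorAlgebra.

(* A linear map is an algebra map when it is a monoid_morphism.               *)
Record hopfAlgebra (K : fieldType) := HopfAlgebra {
  hopf_alg :> finAlgType K;
  comul : 'Hom(hopf_alg, tensor hopf_alg hopf_alg);
  counit : 'Hom(hopf_alg, K^o);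
  antipode : 'End(hopf_alg);
  comul_morph : monoid_morphism comul;
  counit_morph : monoid_morphism counit;
  comul_coassoc : forall h,
    tassoc _ _ _ (tmap comul \1%VF (comul h)) = tmap \1%VF comul (comul h);
  comul_counitl : forall h, tlift (fun x y => (counit x : K) *: y) (comul h) = h;
  comul_counitr : forall h, tlift (fun x y => (counit y : K) *: x) (comul h) = h;
  antipodel : forall h,
    tlift (fun x y : hopf_alg => antipode x * y) (comul h) = (counit h : K) *: (1 : hopf_alg);
  antipoder : forall h,
    tlift (fun x y : hopf_alg => x * antipode y) (comul h) = (counit h : K) *: (1 : hopf_alg)
}.

Record comodAlgebra (K : fieldType) (H : hopfAlgebra K) := ComodAlgebra {
  comod_alg :> finAlgType K;
  coact : 'Hom(comod_alg, tensor H comod_alg);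
  coact_morph : monoid_morphism coact;
  coact_coassoc : forall a,
    tassoc _ _ _ (tmap (comul H) \1%VF (coact a)) = tmap \1%VF coact (coact a);
  coact_counit : forall a, tlift (fun x y => (counit H x : K) *: y) (coact a) = a
}.

Record finModule (K : fieldType) (A : finAlgType K) := FinModule {
  mod_space :> vectType K;
  act : 'Hom(A, 'End(mod_space));
  act1 : act 1 = \1%VF;
  actM : forall a b, act (a * b) = (act a \o act b)%VF
}.

Definition module_hom (K : fieldType) (A : finAlgType K) (M N : finModule A)
    (f : 'Hom(M, N)) : Prop :=
  forall (a : A) (m : M), f (act M a m) = act N a (f m).

(* Epimorphisms of finite-dimensional modules are the surjective ones.        *)
Definition projective (K : fieldType) (A : finAlgType K) (P : finModule A) :
    Prop :=
  forall (M N : finModule A) (g : 'Hom(M, N)) (f : 'Hom(P, N)),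
    module_hom g -> (forall n, exists m, g m = n) -> module_hom f ->
  exists2 h : 'Hom(P, M), module_hom h & forall p, g (h p) = f p.

Section ModuleCategory.
Variables (K : fieldType) (H : hopfAlgebra K) (L : comodAlgebra H).
Variables (X : finModule H) (M : finModule L).

Definition tact_pair : 'Hom(tensor H L, 'End(tensor X M)) :=
  tlift (fun (h : H) (b : L) => tmap (act X h) (act M b)).

Definition tact : 'Hom(L, 'End(tensor X M)) := (tact_pair \o coact L)%VF.

Lemma tact_pairE (h : H) (b : L) (x : X) (m : M) :
  tact_pair (h \ox b) (x \ox m) = act X h x \ox act M b m.
Proof.
have [bl br] := @tmap_bilinear K X M X M.
rewrite tliftE ?tmapE //.
by split=> [{}b | {}h] c y z; rewrite linearP ?bl ?br.
Qed.

Lemma tact_pair1 : tact_pair 1 = \1%VF.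
Proof.
apply: tensor_lfunP => x m.
by rewrite tensor_oneE tact_pairE !act1 !id_lfunE.
Qed.

Lemma tact_pairM s t : tact_pair (s * t) = (tact_pair s \o tact_pair t)%VF.
Proof.
elim/tensor_ind: s => [s s' es es' | h b].
  by rewrite mulrDl !linearD /= es es' comp_lfunDl.
elim/tensor_ind: t => [t t' et et' | h' b'].
  by rewrite mulrDr !linearD /= et et' comp_lfunDr.
apply: tensor_lfunP => x m.
by rewrite tensor_mulE comp_lfunE !tact_pairE !actM !comp_lfunE.
Qed.

Lemma tact1 : tact 1 = \1%VF.
Proof. by rewrite /tact comp_lfunE (coact_morph L).1 tact_pair1. Qed.

Lemma tactM a b : tact (a * b) = (tact a \o tact b)%VF.
Proof. by rewrite /tact !comp_lfunE (coact_morph L).2 tact_pairM. Qed.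

(* X |> M = X (x) M with a (x \ox m) = (a_(-1) x) \ox (a_(0) m).              *)
Definition mod_tensor : finModule L :=
  @FinModule K L (tensor X M) tact tact1 tactM.

End ModuleCategory.

Definition exact_comodAlgebra (K : fieldType) (H : hopfAlgebra K)
    (L : comodAlgebra H) : Prop :=
  forall (P : finModule H) (M : finModule L),
    projective P -> projective (mod_tensor P M).

(* The linear form x |-> lambda (a * x).                                      *)
Definition lform_mul (K : fieldType) (A : finAlgType K) (lambda : 'Hom(A, K^o))
    (a : A) : 'Hom(A, K^o) :=
  linfun (fun x => lambda (a * x)).

Lemma lform_mulE (K : fieldType) (A : finAlgType K) (lambda : 'Hom(A, K^o))
    (a x : A) : lform_mul lambda a x = lambda (a * x).
Proof.
by rewrite linfunE // => c y z; rewrite mulrDr -fscalerAr linearP.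
Qed.

Definition frobenius_algebra (K : fieldType) (A : finAlgType K) : Prop :=
  exists lambda : 'Hom(A, K^o), bijective (lform_mul lambda).

(* Main.v *)
Require Import Defs.
From mathcomp Require Import all_boot all_order all_algebra.
From mathcomp Require Import zify.
From Stdlib Require Import Classical.

Set Implicit Arguments.
Unset Strict Implicit.
Unset Printing Implicit Defensive.

Import Defs GRing.Theory VectorInternalTheory.
Local Open Scope ring_scope.

(** Let D be the left module L^* of linear forms, (a phi)(x) = phi(x a).  The
    algebra L is Frobenius as soon as D is cyclic: if D = L lambda, then
    (x, y) |-> lambda(x y) is nondegenerate.  Writing u(M) for the dimension
    of Hom_L(D, M), it is enough that u(M) <= dim M for all M
    ([quotient_cyclic]); this says that each simple module occurs in the top
    of D at most as often as in the top of L.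

    The Hopf algebra enters through the functor F(M) = H (x) M.
    - F(M) is projective, by exactness, and maps onto M by eps (x) id.
    - D is a retract of F(D).  Elements of H (x) L^* are linear maps L -> H,
      and phi |-> (b |-> S(b_(-1)) phi(b_(0))) is an L-linear section of
      eps (x) id ([twisted_coact]).  Hence D is projective and u is additive.
    - u(F(M)) >= (dim H) u(M) ([hdim_tensor_ge]): an element h of H and T in
      Hom_L(D, M) yield the map phi |-> (id (x) T)(phi_1 h (x) phi_0), where
      phi_1 (x) phi_0 is the twisted coaction of phi, and these maps separate
      the elements of H (x) Hom_L(D, M) because S^2(b_(2)) S(b_(1)) = eps(b).

    The bound u(M) <= dim M then follows by a Perron-Frobenius argument
    ([dual_hdim_le]).  Let c be the maximum of u(M) / dim M over nonzero M, and
    call M extremal when u(M) = c dim M.  Extremal modules are closed under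
    submodules, quotients, extensions, and under F since dim F(M) =
    (dim H) dim M.  Let R be the common annihilator of all extremal modules,
    a two-sided ideal; the modules killed by R are exactly the extremal ones,
    so L/R and F(L/R) are extremal.  Lifting F(L/R) -> L/R, whose source is
    projective and killed by R, through L -> L/R yields an element e of L with
    e = 1 modulo R and R e = 0.  Then G = e D is a nonzero extremal module, and
    a homomorphism T : D -> G is determined by the linear form w |-> T(w)(1) on
    G, because T(phi) = e T(phi) = T(e phi).
    So c dim G = u(G) <= dim G, that is c <= 1.

    The antipode is handled through matrices c over H with
    Delta(c_ij) = sum_k c_ik (x) c_kj and eps(c_ij) = delta_ij, such as the
    coefficient matrix of a comodule in a basis: S(c) is the inverse of c, and
    applied to Kronecker products this shows that S reverses products. *)

(** * Linear maps and dimensions *)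

Section LinearAlgebra.
Variable K : fieldType.
Implicit Types U V W : vectType K.

Lemma linfun2E U V W (b : U -> V -> W) u v :
  bilinear_map b -> linfun (fun x => linfun (b x)) u v = b u v.
Proof.
case=> bl br; rewrite linfunE ?linfunE // => c x y.
by apply/lfunP=> w; rewrite add_lfunE scale_lfunE !linfunE ?bl.
Qed.

Lemma comp_lfun_bilinear U V W :
  bilinear_map (fun (g : 'Hom(V, W)) (f : 'Hom(U, V)) => (g \o f)%VF).
Proof.
by split=> [f | g] c x y; apply/lfunP=> u;
  rewrite !(comp_lfunE, add_lfunE, scale_lfunE) ?linearP.
Qed.

Definition postcomp U V W (g : 'Hom(V, W)) : 'Hom('Hom(U, V), 'Hom(U, W)) :=
  linfun (comp_lfun g).

Lemma postcompE U V W (g : 'Hom(V, W)) (f : 'Hom(U, V)) :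
  postcomp U g f = (g \o f)%VF.
Proof. by rewrite linfunE //; apply: (comp_lfun_bilinear U V W).2. Qed.

Lemma lker_injective V W (f : 'Hom(V, W)) : injective f -> lker f = 0%VS.
Proof. by move/lker0P/eqP. Qed.

Lemma dim_limg_inj V W (f : 'Hom(V, W)) (U : {vspace V}) :
  injective f -> \dim (f @: U) = \dim U.
Proof. by move=> fI; rewrite limg_dim_eq // lker_injective // capv0. Qed.

Lemma limg_surj V W (f : 'Hom(V, W)) :
  (forall w, exists v, f v = w) -> limg f = {: W}%VS.
Proof.
move=> fS; apply/vspaceP=> w; rewrite memvf; have [v <-] := fS w.
exact/memv_img/memvf.
Qed.

Lemma surj_lfun_invK V W (f : 'Hom(V, W)) :
  (forall w, exists v, f v = w) -> cancel (f^-1)%VF f.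
Proof. by move=> fS w; rewrite limg_lfunVK ?limg_surj ?memvf. Qed.

Lemma dim_exact U V W (i : 'Hom(U, V)) (g : 'Hom(V, W)) :
    injective i -> (forall w, exists v, g v = w) ->
    (forall v, g v = 0 <-> exists u, i u = v) ->
  dim V = (dim U + dim W)%N.
Proof.
move=> iI gS ex; rewrite -!dimvf -(limg_surj gS) -(dim_limg_inj _ iI).
rewrite -[in LHS](limg_ker_dim g) capfv; congr (\dim _ + _)%N.
apply/vspaceP=> v; rewrite memv_ker; apply/eqP/memv_imgP.
- by move=> /ex[u <-]; exists u; rewrite ?memvf.
- by case=> u _ ->; apply/ex; exists u.
Qed.

Lemma dim_surj V W (g : 'Hom(V, W)) :
  (forall w, exists v, g v = w) -> (dim W <= dim V)%N.
Proof.
by move=> gS; rewrite -!dimvf -(limg_surj gS) -(limg_ker_dim g {:V}) leq_addl.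
Qed.

Lemma dim_eq0_eq V : dim V = 0%N -> forall v w : V, v = w.
Proof.
move=> V0; suff z (v : V) : v = 0 by move=> v w; rewrite (z v) (z w).
have /eqP : (\dim {:V} = 0)%N by rewrite dimvf.
by rewrite dimv_eq0 => /eqP v0; apply/eqP; rewrite -memv0 -v0 memvf.
Qed.

Lemma dim_gt0_neq V (v : V) : v != 0 -> (0 < dim V)%N.
Proof.
by apply: contraNltn; rewrite leqn0 => /eqP V0; apply/eqP/(dim_eq0_eq V0).
Qed.

Lemma dim_gt0_ex V : (0 < dim V)%N -> exists v : V, v != 0.
Proof.
move=> V0; exists (vpick {:V}); rewrite vpick0 -dimv_eq0 dimvf; lia.
Qed.

Lemma dim_hom V W : dim 'Hom(V, W) = (dim V * dim W)%N.
Proof. by []. Qed.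

Lemma dim_tensor V W : dim (tensor V W) = (dim V * dim W)%N.
Proof. by []. Qed.

Lemma v2r_tbasis V (i j : 'I_(dim V)) :
  v2r (tbasis i) 0 j = (j == i)%:R :> K.
Proof. by rewrite r2vK mxE eqxx. Qed.

Definition dbasis V (i : 'I_(dim V)) : 'Hom(V, K^o) :=
  linfun (fun v => v2r v 0 i : K^o).

Lemma dbasisE V (i : 'I_(dim V)) v : dbasis i v = v2r v 0 i.
Proof. by rewrite linfunE // => c x y; rewrite linearP !mxE. Qed.

Lemma dbasis_sum V (phi : 'Hom(V, K^o)) :
  phi = \sum_i (phi (tbasis i) : K) *: dbasis i.
Proof.
apply/lfunP=> v; rewrite sum_lfunE [in LHS](tbasis_sum v) linear_sum.
apply: eq_bigr => i _; rewrite linearZ scale_lfunE dbasisE /=.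
by rewrite /GRing.scale /= mulrC.
Qed.

Lemma dual_eq0 V (v : V) : (forall phi : 'Hom(V, K^o), phi v = 0) -> v = 0.
Proof.
move=> v0; rewrite [v]tbasis_sum big1 // => i _.
by rewrite -dbasisE v0 scale0r.
Qed.

(** Projection onto a complement of U: a model of the quotient map V -> V/U,
    whose target has to be a vectType. *)
Definition quo V (U : {vspace V}) : 'Hom(V, subvs_of U^C%VS) :=
  (linfun (vsproj U^C%VS) \o daddv_pi U^C U)%VF.

Lemma quo_vsval V (U : {vspace V}) w : quo U (vsval w) = w.
Proof.
rewrite comp_lfunE lfunE /= daddv_pi_id ?vsvalK ?subvsP //.
by rewrite capvC capv_compl.
Qed.

Lemma quo_surj V (U : {vspace V}) w : exists v, quo U v = w.
Proof. by exists (vsval w); apply: quo_vsval. Qed.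

Lemma quo_eq0 V (U : {vspace V}) v : quo U v = 0 <-> v \in U.
Proof.
have cap0 : (U^C :&: U)%VS = 0%VS by rewrite capvC capv_compl.
have cap0' := capv_compl U.
have vE := @daddv_pi_add _ _ U^C%VS U v cap0.
rewrite addvC addv_complf memvf in vE; have {}vE := vE isT.
rewrite comp_lfunE lfunE /=; split=> [/(congr1 vsval) | vU].
  by rewrite vsprojK ?memv_pi //= => v0; rewrite -vE v0 add0r memv_pi.
suff -> : daddv_pi U^C U v = 0 by rewrite linear0.
by apply: (addIr v); rewrite -{2}(daddv_pi_id cap0' vU) vE add0r.
Qed.

Lemma linear_vsval V (U : {vspace V}) u : linfun (@vsval _ _ U) u = vsval u.
Proof. exact: lfunE. Qed.

End LinearAlgebra.
Lemma ex_minnat (P : nat -> Prop) : (exists n, P n) ->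
  exists2 n, P n & forall m, P m -> (n <= m)%N.
Proof.
case=> n; elim/ltn_ind: n => n IH Pn.
have [[m mn Pm] | no] := classic (exists2 m, (m < n)%N & P m).
  exact: IH Pm.
exists n => // m Pm; rewrite leqNgt; apply/negP=> mn; apply: no.
by exists m.
Qed.

Lemma ex_maxnat (P : nat -> Prop) b : (exists n, P n) ->
    (forall n, P n -> (n <= b)%N) ->
  exists2 n, P n & forall m, P m -> (m <= n)%N.
Proof.
move=> [n Pn] Pb.
have [|d [m Pm ->{d}] dmin] :=
  @ex_minnat (fun d => exists2 m, P m & d = (b - m)%N).
  by exists (b - n)%N, n.
exists m => // m' Pm'.
have := dmin (b - m')%N (ex_intro2 _ _ _ Pm' erefl).
by have := Pb _ Pm; have := Pb _ Pm'; lia.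
Qed.

(** * Constructions of modules *)

Section Modules.
Variables (K : fieldType) (A : finAlgType K).
Implicit Types M N P : finModule A.

Section Build.
Variables (V : vectType K) (f : A -> V -> V).
Hypothesis f_bilin : bilinear_map f.
Hypothesis f1 : forall v, f 1 v = v.
Hypothesis fM : forall a b v, f (a * b) v = f a (f b v).

Lemma mkmod_act1 : linfun (fun a => linfun (f a)) 1 = \1%VF.
Proof. by apply/lfunP=> v; rewrite linfun2E // id_lfunE. Qed.

Lemma mkmod_actM a b : linfun (fun a => linfun (f a)) (a * b) =
  (linfun (fun a => linfun (f a)) a \o linfun (fun a => linfun (f a)) b)%VF.
Proof. by apply/lfunP=> v; rewrite comp_lfunE !linfun2E. Qed.

Definition mkmod : finModule A := FinModule mkmod_act1 mkmod_actM.

Lemma mkmodE a (v : V) : act mkmod a v = f a v.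
Proof. exact: linfun2E. Qed.
End Build.

Lemma act1E M m : act M 1 m = m.
Proof. by rewrite act1 id_lfunE. Qed.

Lemma actME M a b m : act M (a * b) m = act M a (act M b m).
Proof. by rewrite actM comp_lfunE. Qed.

Lemma act_bilinear M : bilinear_map (fun a m => act M a m).
Proof.
by split=> [m | a] c x y; rewrite ?linearP // add_lfunE scale_lfunE.
Qed.

Definition orbit M m : 'Hom(A, M) := linfun (fun a => act M a m).

Lemma orbitE M m a : orbit m a = act M a m.
Proof. by rewrite linfunE //; apply: (act_bilinear M).1. Qed.

Lemma mul_bilinear : bilinear_map (fun a b : A => a * b).
Proof.
by split=> [b | a] c x y; rewrite ?mulrDl ?mulrDr -?fscalerAl -?fscalerAr.
Qed.

Definition rmul (a : A) : 'End(A) := linfun (fun x : A => x * a).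

Lemma rmulE a x : rmul a x = x * a.
Proof. by rewrite linfunE //; apply: mul_bilinear.1. Qed.

Definition regmod : finModule A := mkmod mul_bilinear (@mul1r A)
  (fun a b v => esym (mulrA a b v)).

Lemma regmodE (a x : A) : act regmod a x = a * x.
Proof. exact: mkmodE. Qed.

Lemma orbit_hom M m : @module_hom _ _ regmod M (orbit m).
Proof. by move=> a x; rewrite regmodE !orbitE actME. Qed.

Lemma dual_bilinear :
  bilinear_map (fun a (phi : 'Hom(A, K^o)) => (phi \o rmul a)%VF).
Proof.
split=> [phi | a] c x y; apply/lfunP=> u;
  rewrite !(comp_lfunE, add_lfunE, scale_lfunE, rmulE) //.
by rewrite mulrDr -fscalerAr linearP.
Qed.

Lemma dual_act1 (phi : 'Hom(A, K^o)) : (phi \o rmul 1)%VF = phi.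
Proof. by apply/lfunP=> x; rewrite comp_lfunE rmulE mulr1. Qed.

Lemma dual_actM a b (phi : 'Hom(A, K^o)) :
  (phi \o rmul (a * b) = (phi \o rmul b) \o rmul a)%VF.
Proof. by apply/lfunP=> x; rewrite !comp_lfunE !rmulE mulrA. Qed.

Definition dualmod : finModule A := mkmod dual_bilinear dual_act1 dual_actM.

Lemma dualmodE a (phi : dualmod) x :
  (act dualmod a phi : 'Hom(A, K^o)) x = (phi : 'Hom(A, K^o)) (x * a).
Proof. by rewrite mkmodE comp_lfunE rmulE. Qed.

Definition stable M (U : {vspace M}) := forall a m, m \in U -> act M a m \in U.

Section Submodule.
Variables (M : finModule A) (U : {vspace M}) (sU : stable U).

Let f a (u : subvs_of U) := vsproj U (act M a (vsval u)).

Lemma submod_bilinear : bilinear_map f.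
Proof.
by split=> [u | a] c x y; rewrite /f !(linearP, add_lfunE, scale_lfunE).
Qed.

Lemma submod_act1 u : f 1 u = u.
Proof. by rewrite /f act1E vsvalK. Qed.

Lemma submod_actM a b u : f (a * b) u = f a (f b u).
Proof. by rewrite /f vsprojK ?actME //; apply: sU; apply: subvsP. Qed.

Definition submod : finModule A :=
  mkmod submod_bilinear submod_act1 submod_actM.

Definition subincl : 'Hom(submod, M) := linfun (@vsval _ _ U).

Lemma subinclE u : subincl u = vsval u.
Proof. exact: linear_vsval. Qed.

Lemma subincl_inj : injective subincl.
Proof. by move=> u v; rewrite !subinclE => /subvs_inj. Qed.

Lemma subincl_hom : module_hom subincl.
Proof.
by move=> a u; rewrite !subinclE mkmodE vsprojK //; apply: sU; apply: subvsP.
Qed.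

Lemma subincl_img m : m \in U <-> exists u, subincl u = m.
Proof.
split=> [mU | [u <-]]; last by rewrite subinclE subvsP.
by exists (vsproj U m); rewrite subinclE vsprojK.
Qed.

Let g a (v : subvs_of U^C%VS) := quo U (act M a (vsval v)).

Lemma quo_act a m : g a (quo U m) = quo U (act M a m).
Proof.
apply/eqP; rewrite -subr_eq0 /g -!linearB /=; apply/eqP/quo_eq0/sU/quo_eq0.
by rewrite linearB /= quo_vsval subrr.
Qed.

Lemma quomod_bilinear : bilinear_map g.
Proof.
by split=> [u | a] c x y; rewrite /g !(linearP, add_lfunE, scale_lfunE).
Qed.

Lemma quomod_act1 v : g 1 v = v.
Proof. by have [m <-] := quo_surj v; rewrite quo_act act1E. Qed.

Lemma quomod_actM a b v : g (a * b) v = g a (g b v).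
Proof. by have [m <-] := quo_surj v; rewrite !quo_act actME. Qed.

Definition quomod : finModule A :=
  mkmod quomod_bilinear quomod_act1 quomod_actM.

Definition quoproj : 'Hom(M, quomod) := quo U.

Lemma quoproj_hom : module_hom quoproj.
Proof. by move=> a m; rewrite /quoproj mkmodE quo_act. Qed.

End Submodule.

Section Product.
Variables M N : finModule A.
Let f a (u : M * N) : M * N := (act M a u.1, act N a u.2).

Lemma prod_bilinear : bilinear_map f.
Proof.
by split=> [u | a] c x y; congr pair;
  rewrite /= !(linearP, add_lfunE, scale_lfunE).
Qed.

Lemma prod_act1 u : f 1 u = u.
Proof. by rewrite /f !act1E; case: u. Qed.

Lemma prod_actM a b u : f (a * b) u = f a (f b u).
Proof. by rewrite /f !actME. Qed.

Definition prodmod : finModule A := mkmod prod_bilinear prod_act1 prod_actM.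

Lemma prodmodE a (u : prodmod) : act prodmod a u = (act M a u.1, act N a u.2).
Proof. exact: mkmodE. Qed.
End Product.

(** ** Homomorphisms *)

(** Commutation with the action is a linear condition, and it can be tested on
    a basis of A; this makes the homomorphisms a {vspace}. *)
Definition homs M N : {vspace 'Hom(M, N)} :=
  (\bigcap_(i < dim A) lker (linfun (fun f : 'Hom(M, N) =>
     (f \o act M (tbasis i)) - (act N (tbasis i) \o f)))%VF)%VS.

Lemma homsP M N (f : 'Hom(M, N)) : f \in homs M N <-> module_hom f.
Proof.
have E a : linfun (fun f : 'Hom(M, N) => ((f \o act M a) - (act N a \o f))%VF) f
    = ((f \o act M a) - (act N a \o f))%VF.
  rewrite linfunE // => c x y.
  rewrite (comp_lfun_bilinear _ _ _).1 (comp_lfun_bilinear _ _ _).2.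
  by rewrite scalerBr opprD addrACA.
split=> [/subv_bigcapP fh a m | fh]; last first.
  apply/subv_bigcapP=> i _; rewrite -memvE memv_ker E subr_eq0.
  by apply/eqP/lfunP=> m; rewrite !comp_lfunE fh.
rewrite [a]tbasis_sum !linear_sum !sum_lfunE linear_sum.
apply: eq_bigr => i _; rewrite !linearZ !scale_lfunE linearZ /=; congr (_ *: _).
have:= fh i isT; rewrite -memvE memv_ker E subr_eq0 => /eqP/lfunP/(_ m).
by rewrite !comp_lfunE.
Qed.

Lemma hom_comp M N P (f : 'Hom(M, N)) (g : 'Hom(N, P)) :
  module_hom f -> module_hom g -> module_hom (g \o f)%VF.
Proof. by move=> fh gh a m; rewrite !comp_lfunE fh gh. Qed.

Lemma hom_factor M N P (g : 'Hom(M, N)) (f : 'Hom(M, P)) :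
    module_hom g -> module_hom f -> (forall n, exists m, g m = n) ->
    (forall m, g m = 0 -> f m = 0) ->
  exists2 h : 'Hom(N, P), module_hom h & forall m, h (g m) = f m.
Proof.
move=> gh fh gS gf.
have hg m : (f \o g^-1)%VF (g m) = f m.
  rewrite comp_lfunE; apply/eqP; rewrite -subr_eq0 -linearB; apply/eqP/gf.
  by rewrite linearB /= surj_lfun_invK // subrr.
by exists (f \o g^-1)%VF => // a n; have [m <-] := gS n; rewrite -gh !hg fh.
Qed.

Lemma ker_stable M N (f : 'Hom(M, N)) : module_hom f -> stable (lker f).
Proof. by move=> fh a n; rewrite !memv_ker fh => /eqP->; rewrite linear0. Qed.

Lemma orbit_stable M (m : M) : stable (limg (orbit m)).
Proof.
move=> a n /memv_imgP[b _ ->]; rewrite orbitE -actME -orbitE.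
exact/memv_img/memvf.
Qed.

Arguments orbit_stable [M] m.

Definition hdim P M := \dim (homs P M).

Lemma hdim_le P M : (hdim P M <= dim P * dim M)%N.
Proof. by rewrite -dim_hom -dimvf dimvS ?subvf. Qed.

(** Hom(P, M) -> Hom(P, M'') is onto as P is projective. *)
Lemma hdim_exact P M' M M'' (i : 'Hom(M', M)) (g : 'Hom(M, M'')) :
    projective P -> module_hom i -> module_hom g ->
    injective i -> (forall w, exists v, g v = w) ->
    (forall v, g v = 0 <-> exists u, i u = v) ->
  hdim P M = (hdim P M' + hdim P M'')%N.
Proof.
move=> Pproj ih gh iI gS ex.
have postI : injective (postcomp P i).
  by move=> f f'; rewrite !postcompE => /lfunP E; apply/lfunP=> p;
    apply: iI; have := E p; rewrite !comp_lfunE.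
rewrite /hdim -(limg_ker_dim (postcomp P g)) -(dim_limg_inj _ postI).
congr (_ + _)%N; congr (\dim _); apply/vspaceP=> f.
  rewrite memv_cap memv_ker postcompE; apply/andP/memv_imgP.
    case=> /homsP fh /eqP/lfunP gf0.
    have fi p : i ((i^-1)%VF (f p)) = f p.
      rewrite limg_lfunVK //; have [u <-] : exists u, i u = f p.
        by apply/ex; have := gf0 p; rewrite comp_lfunE zero_lfunE.
      exact/memv_img/memvf.
    exists (i^-1 \o f)%VF.
      by apply/homsP=> a p; apply: iI; rewrite !comp_lfunE ih !fi fh.
    by rewrite postcompE; apply/lfunP=> p; rewrite !comp_lfunE fi.
  case=> f' /homsP f'h ->; rewrite postcompE; split.
    exact/homsP/hom_comp.
  apply/eqP/lfunP=> p; rewrite !comp_lfunE zero_lfunE; apply/ex.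
  by exists (f' p).
apply/memv_imgP/idP.
  by case=> f' /homsP f'h ->; rewrite postcompE; apply/homsP/hom_comp.
move/homsP=> fh; have [h hh gE] := Pproj _ _ _ _ gh gS fh.
exists h; first exact/homsP.
by rewrite postcompE; apply/lfunP=> p; rewrite comp_lfunE gE.
Qed.

Lemma dim_sub_quo M (U : {vspace M}) (sU : stable U) :
  dim M = (dim (submod sU) + dim (quomod sU))%N.
Proof.
apply: (@dim_exact _ _ _ _ (subincl sU) (quoproj sU)).
- exact: subincl_inj.
- exact: quo_surj.
- move=> v; rewrite -subincl_img; exact: quo_eq0.
Qed.

Lemma hdim_sub_quo P M (U : {vspace M}) (sU : stable U) : projective P ->
  hdim P M = (hdim P (submod sU) + hdim P (quomod sU))%N.
Proof.
move=> Pproj; apply: (@hdim_exact _ _ _ _ (subincl sU) (quoproj sU)) => //.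
- exact: subincl_hom.
- exact: quoproj_hom.
- exact: subincl_inj.
- exact: quo_surj.
- move=> v; rewrite -subincl_img; exact: quo_eq0.
Qed.

End Modules.

Arguments orbit_stable [K A M] m.

(** * Dimensions of spaces of homomorphisms out of a projective module *)

Section Devissage.
Variables (K : fieldType) (A : finAlgType K).
Implicit Types M N P X : finModule A.

Definition gen M (m : M) : submod (orbit_stable m) :=
  @vsproj K M (limg (orbit m)) m.

Lemma gen_val M (m : M) : subincl (orbit_stable m) (gen m) = m.
Proof.
rewrite subinclE vsprojK // -[X in X \in _](act1E m) -orbitE.
exact/memv_img/memvf.
Qed.

Lemma gen_surj M (m : M) (s : submod (orbit_stable m)) :
  exists a, orbit (gen m) a = s.
Proof.
have /memv_imgP[a _ sE] := subvsP s; exists a.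
apply: (@subincl_inj _ _ _ _ (orbit_stable m)).
by rewrite orbitE subincl_hom gen_val subinclE sE orbitE.
Qed.

Lemma dim_orbit_gt0 M (m : M) : m != 0 -> (0 < dim (submod (orbit_stable m)))%N.
Proof.
move=> m0; apply: (@dim_gt0_neq _ _ (gen m)).
by apply: contraNneq m0 => E; rewrite -(gen_val m) E linear0.
Qed.

Lemma dim_orbit_le M (m : M) : (dim (submod (orbit_stable m)) <= dim A)%N.
Proof. exact: (dim_surj (@gen_surj M m)). Qed.

(** Every module is an iterated extension of cyclic ones, so an additive bound
    has to be checked on modules of dimension at most dim A only. *)
Lemma cyclic_devissage (Q : finModule A -> Prop) :
    (forall M, dim M = 0%N -> Q M) ->
    (forall M (m : M), m != 0 -> Q (quomod (orbit_stable m)) -> Q M) ->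
  forall M, Q M.
Proof.
move=> Q0 QS M; have [d] := ubnP (dim M); elim: d M => // d IH M Md.
have [/Q0 // | /dim_gt0_ex[m m0]] := posnP (dim M).
apply: (QS M m m0); apply: IH.
by have := dim_sub_quo (orbit_stable m); have := dim_orbit_gt0 m0; lia.
Qed.

Lemma hdim_dim0 P M : dim M = 0%N -> hdim P M = 0%N.
Proof. by move=> M0; have := hdim_le P M; rewrite M0 muln0 leqn0 => /eqP. Qed.

(** The maximum p/q of hdim P M / dim M exists because, by
    [cyclic_devissage], only the finitely many dimensions up to dim A matter. *)
Lemma max_ratio P X : projective P -> (0 < dim X)%N ->
  exists p q, [/\ (0 < q)%N,
    forall M : finModule A, (q * hdim P M <= p * dim M)%N &
    exists2 M : finModule A, (0 < dim M)%N & (q * hdim P M = p * dim M)%N].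
Proof.
(* A common denominator turns the ratios into natural numbers. *)
move=> Pproj X0; pose q := (dim A)`!.
pose val (M : finModule A) := (hdim P M * (q %/ dim M))%N.
have valE (M : finModule A) : (0 < dim M <= dim A)%N ->
    (q * hdim P M = val M * dim M)%N.
  move=> Mr; have := divnK (dvdn_fact Mr); rewrite -/q => {1}<-.
  by rewrite /val; lia.
pose S v := exists2 M : finModule A, (0 < dim M <= dim A)%N & v = val M.
have [||p [M Mr pE] pmax] := @ex_maxnat S (dim P * dim A * q)%N.
- have [x x0] := dim_gt0_ex X0.
  exists (val (submod (orbit_stable x))), (submod (orbit_stable x)) => //.
  by rewrite dim_orbit_gt0 ?dim_orbit_le.
- move=> _ [M /andP[_ Ml] ->]; rewrite leq_mul ?leq_div //.
  by apply: leq_trans (hdim_le P M) _; rewrite leq_mul.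
exists p, q; split; first exact: fact_gt0; last first.
  by exists M; [case/andP: Mr | rewrite valE // pE].
move=> {M Mr pE}; apply: cyclic_devissage => [M M0 | M m m0 IH].
  by rewrite hdim_dim0 // muln0.
rewrite (hdim_sub_quo (orbit_stable m)) // (dim_sub_quo (orbit_stable m)).
rewrite !mulnDr leq_add // valE ?dim_orbit_gt0 ?dim_orbit_le //.
rewrite leq_mul2r pmax ?orbT //; exists (submod (orbit_stable m)) => //.
by rewrite dim_orbit_gt0 ?dim_orbit_le.
Qed.

Section Extremal.
Variables (P : finModule A) (p q : nat).
Hypothesis Pproj : projective P.
Hypothesis bnd : forall M : finModule A, (q * hdim P M <= p * dim M)%N.

(** The modules where the bound on hdim P is attained.  Both sides of the bound
    are additive, so in an exact sequence the middle term is extremal iff both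
    ends are. *)
Definition extremal M := (q * hdim P M = p * dim M)%N.

Lemma extremal_exact M' M M'' (i : 'Hom(M', M)) (g : 'Hom(M, M'')) :
    module_hom i -> module_hom g ->
    injective i -> (forall w, exists v, g v = w) ->
    (forall v, g v = 0 <-> exists u, i u = v) ->
  extremal M <-> extremal M' /\ extremal M''.
Proof.
move=> ih gh iI gS ex; rewrite /extremal (hdim_exact Pproj ih gh iI gS ex).
rewrite (dim_exact iI gS ex) !mulnDr.
have := bnd M'; have := bnd M''; lia.
Qed.

Lemma extremal_sub_quo M (U : {vspace M}) (sU : stable U) :
  extremal M <-> extremal (submod sU) /\ extremal (quomod sU).
Proof.
apply: (@extremal_exact _ _ _ (subincl sU) (quoproj sU)) => //.
- exact: subincl_hom.
- exact: quoproj_hom.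
- exact: subincl_inj.
- exact: quo_surj.
- move=> v; rewrite -subincl_img; exact: quo_eq0.
Qed.

Lemma extremal_surj M N (g : 'Hom(M, N)) :
  module_hom g -> (forall n, exists m, g m = n) -> extremal M -> extremal N.
Proof.
move=> gh gS.
suff E : extremal M <-> extremal (submod (ker_stable gh)) /\ extremal N.
  by case/E.
apply: (@extremal_exact _ _ _ (subincl (ker_stable gh)) g) => //.
- exact: subincl_hom.
- exact: subincl_inj.
- by move=> v; rewrite -subincl_img memv_ker; split=> /eqP.
Qed.

Lemma extremal_prod M N : extremal M -> extremal N -> extremal (prodmod M N).
Proof.
move=> gM gN.
pose i : 'Hom(M, prodmod M N) := linfun (fun m : M => (m, 0) : prodmod M N).
pose g : 'Hom(prodmod M N, N) := linfun (fun mn : prodmod M N => mn.2).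
have iE m : i m = (m, 0).
  by rewrite linfunE // => c x y; congr pair; rewrite /= scaler0 addr0.
have gE mn : g mn = mn.2 by rewrite linfunE.
suff E : extremal (prodmod M N) <-> extremal M /\ extremal N by apply/E.
apply: (@extremal_exact _ _ _ i g).
- by move=> a m; rewrite !iE prodmodE /= linear0.
- by move=> a mn; rewrite !gE prodmodE.
- by move=> m m'; rewrite !iE => -[].
- by move=> n; exists (0, n); rewrite gE.
- move=> [m n]; rewrite gE /=; split=> [-> | [m']]; first by exists m.
  by rewrite iE => -[].
Qed.

End Extremal.

End Devissage.

(** * The dual of the regular module *)

Section DualCyclic.
Variables (K : fieldType) (A : finAlgType K).
Local Notation D := (dualmod A).

(** F stands for M |-> H (x) M; these five properties are all that is used of
    the Hopf algebra. *)
Section Bound.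
Variables (F : finModule A -> finModule A) (n : nat).
Hypothesis F_proj : forall M, projective (F M).
Hypothesis F_cover : forall M : finModule A,
  exists2 g : 'Hom(F M, M), module_hom g & forall m, exists x, g x = m.
Hypothesis F_dim : forall M : finModule A, dim (F M) = (n * dim M)%N.
Hypothesis F_hdim : forall M, (n * hdim D M <= hdim D (F M))%N.
Hypothesis D_proj : projective D.

(** A ratio p/q > 1 is excluded by exhibiting one nonzero extremal module G with
    hdim D G <= dim G, namely G = e D for an element e with e = 1 modulo R and
    R e = 0, obtained from the projectivity of F(A/R). *)
Lemma dual_hdim_le (M : finModule A) : (hdim D M <= dim M)%N.
Proof.
rewrite leqNgt; apply/negP=> ltM.
have M_gt0 : (0 < dim M)%N.
  by rewrite lt0n; apply: contraTneq ltM => M0; rewrite hdim_dim0.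
have [p [q [q_gt0 bnd [X X_gt0 gX]]]] := max_ratio D_proj M_gt0.
have lt_qp : (q < p)%N.
  have := bnd M; have : (q * dim M < q * hdim D M)%N by rewrite ltn_pmul2l.
  move=> h1 h2; have := leq_trans h1 h2.
  by rewrite ltn_mul2r => /andP[].
pose ext M := extremal D p q M.
have ext_F N : ext N -> ext (F N).
  rewrite /ext /extremal => gN; apply/eqP; rewrite eqn_leq bnd F_dim /=.
  by rewrite mulnCA -gN mulnCA leq_mul.
(* By minimality the annihilator R of m is contained in that of any element y
   of an extremal module: compare with (m, y) in the direct sum. *)
have [_ [N0 [m gN0 ->]] Rmin] := @ex_minnat (fun d => exists N : finModule A,
  exists2 m : N, ext N & d = \dim (lker (orbit m)))
  (ex_intro _ _ (ex_intro _ X (ex_intro2 _ _ 0 gX erefl))).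
pose R := lker (orbit m).
have RE r : r \in R <-> act N0 r m = 0.
  by rewrite memv_ker orbitE; split=> /eqP.
have kill (Y : finModule A) (y : Y) r : ext Y -> r \in R -> act Y r y = 0.
  move=> gY rR; pose my : prodmod N0 Y := (m, y).
  have sub : (lker (orbit my) <= R)%VS.
    apply/subvP=> a; rewrite memv_ker orbitE prodmodE => /eqP[am _].
    exact/RE.
  have : r \in lker (orbit my).
    suff /eqP-> : lker (orbit my) == R by [].
    rewrite eqEdim sub /=; apply: Rmin; exists (prodmod N0 Y), my => //.
    exact: extremal_prod.
  by rewrite memv_ker orbitE prodmodE => /eqP[_].
pose N := submod (orbit_stable m); pose mN : N := gen m.
have gN : ext N.
  by have /(extremal_sub_quo D_proj bnd (orbit_stable m))[] := gN0.
have RN r : r \in R <-> act N r mN = 0.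
  split=> [/kill-> // | rm]; apply/RE.
  by rewrite -(gen_val m) -subincl_hom rm linear0.
have Rideal r a : r \in R -> r * a \in R.
  by move=> rR; apply/RE; rewrite actME kill.
(* N is isomorphic to A/R; lifting F N -> N through A -> N gives e. *)
have [g gh gS] := F_cover N.
have [z zE] := gS mN.
have [h hh hE] := F_proj (orbit_hom mN) (@gen_surj _ _ _ m) gh.
pose e := h z.
have Re r : r \in R -> r * e = 0.
  move=> rR; rewrite -(regmodE r e) -hh.
  by rewrite (kill (F N)) ?linear0 //; apply: ext_F.
have eR : 1 - e \in R.
  apply/RN; rewrite linearB add_lfunE opp_lfunE -[act N e _]orbitE hE zE.
  by rewrite act1E subrr.
(* A cyclic module killed by R is a quotient of N. *)
have killed_extremal (Y : finModule A) :
    (forall r (y : Y), r \in R -> act Y r y = 0) -> ext Y.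
  move: Y; apply: cyclic_devissage => [Y Y0 _ | Y y y0 IH kY].
    by rewrite /ext /extremal hdim_dim0 ?Y0 ?muln0.
  apply/(extremal_sub_quo D_proj bnd (orbit_stable y)); split; last first.
    apply: IH => r w rR; have [v <-] := quo_surj w.
    by rewrite -(quoproj_hom (orbit_stable y)) kY // linear0.
  have [|k kh kE] :=
    hom_factor (orbit_hom mN) (orbit_hom (gen y)) (@gen_surj _ _ _ m).
    move=> a; rewrite !orbitE => /RN aR; apply: subincl_inj.
    by rewrite linear0 subincl_hom kY.
  apply: (extremal_surj D_proj bnd kh _ gN) => s.
  by have [a <-] := gen_surj s; exists (orbit mN a); rewrite kE.
(* (1 - e) a lies in the two-sided ideal R, and R e = 0. *)
have ae a : e * a * e = a * e.
  apply/eqP; rewrite -subr_eq0 -opprB oppr_eq0 -!mulrA -{1}[a * e]mul1r -mulrBl.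
  by rewrite mulrA Re // Rideal.
pose U := limg (act D e).
have Ust : stable U.
  move=> a _ /memv_imgP[phi _ ->]; rewrite -actME -ae -mulrA actME.
  exact/memv_img/memvf.
pose G := submod Ust.
have gG : ext G.
  apply: killed_extremal => r w rR; apply: (@subincl_inj _ _ _ _ Ust).
  rewrite linear0 subincl_hom subinclE.
  have /memv_imgP[phi _ ->] := subvsP w.
  by rewrite -actME Re // linear0 zero_lfunE.
have G_gt0 : (0 < dim G)%N.
  rewrite lt0n; apply/eqP=> G0; have e0 : e = 0.
    apply: dual_eq0 => phi; rewrite -[e]mul1r -(dualmodE e phi 1).
    have : act D e phi \in U by apply/memv_img/memvf.
    by case/subincl_img => w <-; rewrite (dim_eq0_eq G0 w 0) linear0 zero_lfunE.
  move: eR; rewrite e0 subr0 => R1.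
  have [x /eqP[]] := dim_gt0_ex X_gt0.
  by rewrite -(act1E x); apply: kill.
suff uG : (hdim D G <= dim G)%N.
  have := leq_mul (leqnn q) uG.
  by rewrite gG leq_mul2r (gtn_eqF G_gt0) leqNgt lt_qp.
(* T is recovered from its values on G, since T(phi) = T(e phi), and the values
   on G from the linear form w |-> T(w)(1), since T(w)(x) = T(x w)(1). *)
have blin (T : 'Hom(D, G)) : linear (fun w : G =>
    (subincl Ust (T (subincl Ust w)) : 'Hom(A, K^o)) 1).
  by move=> c x y; rewrite !linearP add_lfunE scale_lfunE.
pose J := linfun (fun T : 'Hom(D, G) => linfun (fun w : G =>
  (subincl Ust (T (subincl Ust w)) : 'Hom(A, K^o)) 1 : K^o)).
have JE T w : J T w = (subincl Ust (T (subincl Ust w)) : 'Hom(A, K^o)) 1.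
  rewrite linfunE ?(linfunE (blin _)) // => c S S'; apply/lfunP=> x.
  rewrite add_lfunE scale_lfunE !(linfunE (blin _)) add_lfunE scale_lfunE.
  by rewrite !linearP add_lfunE scale_lfunE.
have <- : \dim (J @: homs D G) = hdim D G.
  apply: limg_dim_eq; apply/eqP; rewrite -subv0; apply/subvP=> T.
  rewrite memv_cap memv_ker => /andP[/homsP Th /eqP/lfunP JT].
  have T0 w : T (subincl Ust w) = 0.
    apply: (@subincl_inj _ _ _ _ Ust); rewrite linear0; apply/lfunP=> x.
    rewrite zero_lfunE -[x]mul1r -dualmodE -subincl_hom -Th -subincl_hom -JE.
    by rewrite JT zero_lfunE.
  rewrite memv0; apply/eqP/lfunP=> phi; rewrite zero_lfunE.
  have : act D e phi \in U by apply/memv_img/memvf.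
  case/subincl_img=> w wE; have := T0 w; rewrite wE Th => eT.
  rewrite -[T phi]act1E -[1](subrK e) linearD add_lfunE eT addr0.
  apply: (@subincl_inj _ _ _ _ Ust); rewrite linear0 subincl_hom subinclE.
  have /memv_imgP[psi _ ->] := subvsP (T phi).
  by rewrite -actME Re // linear0 zero_lfunE.
apply: leq_trans (dimvS (subvf _)) _.
by rewrite dimvf dim_hom muln1.
Qed.

End Bound.

(** Lift a generator x of Q/U, for U a minimal submodule, to Q.  If neither x
    nor any x + s with s in U generates Q, then Q is the direct sum of A x and
    U, and every s in U is the image of x under a homomorphism Q -> U that kills
    U.  Together with the projection onto U, which kills x, these span a space
    of homomorphisms of dimension more than dim U. *)
Lemma quotient_cyclic (P : finModule A) :
    (forall S : finModule A, (hdim P S <= dim S)%N) ->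
  forall (Q : finModule A) (g : 'Hom(P, Q)),
    module_hom g -> (forall y, exists x, g x = y) ->
  exists x : Q, forall y, exists a, act Q a x = y.
Proof.
move=> Pb Q; have [d] := ubnP (dim Q); elim: d Q => // d IH Q Qd g gh gS.
have [Q0 | /dim_gt0_ex[q q0]] := posnP (dim Q).
  by exists 0 => y; exists 0; apply: dim_eq0_eq.
pose isub k := exists U : {vspace Q},
  [/\ stable U, (0 < \dim U)%N & k = \dim U].
have [|_ [U [Ust U0 ->]] Umin] := @ex_minnat isub.
  exists (\dim {:Q}), {:Q}%VS; split=> //; first by move=> *; apply: memvf.
  by rewrite dimvf; apply: dim_gt0_neq q0.
have simple (V : {vspace Q}) v :
    stable V -> v \in V -> v \in U -> v != 0 -> (U <= V)%VS.
  move=> Vst vV vU v0.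
  have WU : (V :&: U <= U)%VS by apply: capvSr.
  suff /eqP <- : (V :&: U)%VS == U by apply: capvSl.
  rewrite eqEdim WU; apply: Umin; exists (V :&: U)%VS; split=> //.
    by move=> a m; rewrite !memv_cap => /andP[/Vst-> /Ust->].
  rewrite lt0n dimv_eq0; apply: contraNneq v0 => W0.
  by rewrite -memv0 -W0 memv_cap vV.
pose S := submod Ust.
have [|||xb xbE] := IH (quomod Ust) _ (quoproj Ust \o g)%VF.
- rewrite -ltnS; apply: (leq_trans _ Qd); rewrite ltnS (dim_sub_quo Ust).
  by rewrite -[X in (X < _)%N]add0n ltn_add2r.
- by apply: hom_comp => //; apply: quoproj_hom.
- move=> y; have [y' <-] := quo_surj y; have [x <-] := gS y'.
  by exists x; rewrite comp_lfunE.
have [x xE] := quo_surj xb.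
have decomp y : exists a, exists2 s, s \in U & y = act Q a x + s.
  have [a] := xbE (quoproj Ust y); rewrite -xE -(quoproj_hom Ust) => aE.
  exists a, (y - act Q a x); last by rewrite addrC subrK.
  by apply/quo_eq0; rewrite linearB /=; apply/eqP; rewrite subr_eq0 -aE.
(* As U is minimal, w = x + s generates Q once A w meets U nontrivially. *)
have gen_of w : (exists2 s, s \in U & w = x + s) ->
    (exists2 v, v \in U & (exists a, act Q a w = v) /\ v != 0) ->
  exists x : Q, forall y, exists a, act Q a x = y.
  case=> s sU wE [v vU [[a av] v0]]; exists w => y.
  have UV : (U <= limg (orbit w))%VS.
    apply: (simple _ v) => //; first exact: orbit_stable.
    by rewrite -av -orbitE; apply/memv_img/memvf.
  have [b [t tU ->]] := decomp y.
  suff : act Q b x + t \in limg (orbit w).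
    by case/memv_imgP=> c _ ->; exists c; rewrite orbitE.
  have -> : x = w - s by rewrite wE addrK.
  rewrite linearB /= -addrA memvD //.
    by rewrite -orbitE; apply/memv_img/memvf.
  by apply: (subvP UV); rewrite memvD // memvN Ust.
have [[a [axU ax0]] | no1] :=
  classic (exists a, act Q a x \in U /\ act Q a x != 0).
  apply: (gen_of x); first by exists 0; rewrite ?mem0v ?addr0.
  by exists (act Q a x) => //; split=> //; exists a.
have ax0 a : act Q a x \in U -> act Q a x = 0.
  by move=> axU; apply/eqP/negPn/negP=> nz; apply: no1; exists a.
have [[s [sU [a [ax as0]]]] | no2] := classic (exists s, s \in U /\
    exists a, act Q a x = 0 /\ act Q a s != 0).
  apply: (gen_of (x + s)); first by exists s.
  exists (act Q a s); first by apply/Ust.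
  by split=> //; exists a; rewrite linearD /= ax add0r.
have as0 a s : act Q a x = 0 -> s \in U -> act Q a s = 0.
  move=> ax sU; apply/eqP/negPn/negP=> nz; apply: no2.
  by exists s; split=> //; exists a.
(* Homomorphisms out of Q = A x + U are built by factoring through j. *)
pose AS := prodmod (regmod A) S.
pose j : 'Hom(AS, Q) :=
  linfun (fun v : AS => act Q v.1 x + subincl Ust v.2).
have jE v : j v = act Q v.1 x + subincl Ust v.2.
  rewrite linfunE // => c y z /=.
  by rewrite !linearP add_lfunE scale_lfunE scalerDr addrACA.
have jh : module_hom j.
  move=> a v; rewrite !jE prodmodE /= regmodE actME subincl_hom.
  by rewrite linearD.
have jS y : exists v, j v = y.
  have [a [s /(subincl_img Ust)[t <-] ->]] := decomp y.
  by exists (a, t); rewrite jE.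
have j0 v : j v = 0 -> act Q v.1 x = 0 /\ v.2 = 0.
  rewrite jE => /eqP; rewrite addr_eq0 => /eqP vE.
  have v1 : act Q v.1 x = 0.
    by apply: ax0; rewrite vE memvN; apply/(subincl_img Ust); exists v.2.
  split=> //; apply: (@subincl_inj _ _ _ _ Ust); rewrite linear0.
  by apply/eqP; rewrite -oppr_eq0 -vE v1.
pose p2 : 'Hom(AS, S) := linfun (fun v : AS => v.2).
have p2E v : p2 v = v.2 by rewrite linfunE.
have p2h : module_hom p2 by move=> a v; rewrite !p2E prodmodE.
have [|T0 T0h T0E] := hom_factor jh p2h jS.
  by move=> v /j0[_]; rewrite p2E.
pose p1 s : 'Hom(AS, S) := linfun (fun v : AS => act S v.1 s).
have p1E s v : p1 s v = act S v.1 s.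
  by rewrite linfunE // => c y z /=; rewrite linearP add_lfunE scale_lfunE.
have p1h s : module_hom (p1 s).
  by move=> a v; rewrite p1E [p1 s v]p1E prodmodE -actME -regmodE.
have [xt xtE] := gS x.
(* Evaluation at a preimage of x is onto S, but T0 o g is in its kernel. *)
pose ev : 'Hom('Hom(P, S), S) := linfun (fun T : 'Hom(P, S) => T xt).
have evE T : ev T = T xt.
  by rewrite linfunE // => c T1 T2; rewrite add_lfunE scale_lfunE.
have evS : (ev @: homs P S)%VS = {:S}%VS.
  apply/vspaceP=> s; rewrite memvf; apply/memv_imgP.
  have [|T Th TE] := hom_factor jh (p1h s) jS.
    move=> v /j0[v1 _]; rewrite p1E; apply: (@subincl_inj _ _ _ _ Ust).
    rewrite linear0 subincl_hom as0 //.
    by apply/(subincl_img Ust); exists s.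
  exists (T \o g)%VF; first exact/homsP/hom_comp.
  rewrite evE comp_lfunE xtE.
  have -> : x = j (1, 0) by rewrite jE /= act1E linear0 addr0.
  by rewrite TE p1E act1E.
have T0g : (T0 \o g)%VF \in (homs P S :&: lker ev)%VS.
  rewrite memv_cap; apply/andP; split; first exact/homsP/hom_comp.
  rewrite memv_ker evE comp_lfunE xtE.
  have -> : x = j (1, 0) by rewrite jE /= act1E linear0 addr0.
  by rewrite T0E p2E.
have := Pb S; rewrite leqNgt => /negP[].
rewrite -dimvf -evS /hdim -(limg_ker_dim ev (homs P S)) -[X in (X < _)%N]add0n.
rewrite ltn_add2r lt0n dimv_eq0; apply/eqP=> ker0.
move: T0g; rewrite ker0 memv0 => /eqP/lfunP T0g.
have : (0 < dim S)%N by [].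
case/dim_gt0_ex=> s /eqP[].
have [y yE] := gS (j (0, s)).
by have := T0g y; rewrite comp_lfunE yE T0E p2E zero_lfunE.
Qed.

(** If every linear form is a translate x |-> lambda(x a), then an element in
    the left radical of (x, y) |-> lambda(x y) is killed by all linear forms. *)
Lemma frobenius_of_cyclic_dual (lambda : D) :
  (forall phi : D, exists a, act D a lambda = phi) -> frobenius_algebra A.
Proof.
move=> cyc; exists lambda.
pose f : 'Hom(A, 'Hom(A, K^o)) := linfun (lform_mul lambda).
have fE a : f a = lform_mul lambda a.
  rewrite linfunE // => c x y; apply/lfunP=> z.
  by rewrite add_lfunE scale_lfunE !lform_mulE mulrDl -fscalerAl linearP.
have fI : injective f.
  move=> a b fab; have f0 : f (a - b) = 0.
    by apply/eqP; rewrite linearB subr_eq0; apply/eqP.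
  apply/eqP; rewrite -subr_eq0; apply/eqP/dual_eq0 => phi.
  have [c <-] := cyc phi; rewrite dualmodE.
  by move: f0; rewrite fE => /lfunP/(_ c); rewrite lform_mulE zero_lfunE.
have fS : limg f = {:'Hom(A, K^o)}%VS.
  apply/eqP; rewrite eqEdim subvf (dim_limg_inj _ fI) !dimvf.
  by rewrite dim_hom muln1 leqnn.
exists (f^-1)%VF => [a | phi]; rewrite -fE.
  by apply: fI; rewrite limg_lfunVK // memv_img ?memvf.
by rewrite limg_lfunVK // fS memvf.
Qed.

Theorem frobenius_criterion (F : finModule A -> finModule A) (n : nat) :
    (forall M, projective (F M)) ->
    (forall M : finModule A, exists2 g : 'Hom(F M, M),
       module_hom g & forall m, exists x, g x = m) ->
    (forall M : finModule A, dim (F M) = (n * dim M)%N) ->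
    (forall M, (n * hdim D M <= hdim D (F M))%N) ->
    projective D ->
  frobenius_algebra A.
Proof.
move=> Fp Fc Fd Fh Dp.
have ub := dual_hdim_le Fp Fc Fd Fh Dp.
have [||x xE] := @quotient_cyclic D ub D \1%VF.
- by move=> a m; rewrite !id_lfunE.
- by move=> y; exists y; rewrite id_lfunE.
exact: frobenius_of_cyclic_dual xE.
Qed.

End DualCyclic.

(** * Tensor coordinates *)

Section TensorCoordinates.
Variables (K : fieldType).
Implicit Types V W : vectType K.

Lemma tpureDl V W (v v' : V) (w : W) : (v + v') \ox w = v \ox w + v' \ox w.
Proof. by have := (tpure_bilinear V W).1 w 1 v v'; rewrite !scale1r. Qed.

Lemma tpureDr V W (v : V) (w w' : W) : v \ox (w + w') = v \ox w + v \ox w'.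
Proof. by have := (tpure_bilinear V W).2 v 1 w w'; rewrite !scale1r. Qed.

Lemma tpure0l V W (w : W) : (0 : V) \ox w = 0.
Proof. by rewrite /tpure linear0 trmx0 mul0mx. Qed.

Lemma tpure0r V W (v : V) : v \ox (0 : W) = 0.
Proof. by rewrite /tpure linear0 mulmx0. Qed.

Lemma tpureZl V W c (v : V) (w : W) : (c *: v) \ox w = c *: (v \ox w).
Proof. by have := (tpure_bilinear V W).1 w c v 0; rewrite tpure0l !addr0. Qed.

Lemma tpureZr V W c (v : V) (w : W) : v \ox (c *: w) = c *: (v \ox w).
Proof. by have := (tpure_bilinear V W).2 v c w 0; rewrite tpure0r !addr0. Qed.

Lemma tpure_suml V W (I : finType) (v : I -> V) (w : W) :
  (\sum_i v i) \ox w = \sum_i v i \ox w.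
Proof.
by elim/big_rec2: _ => [|i x y _ <-]; rewrite ?tpure0l // tpureDl.
Qed.

Lemma tpure_sumr V W (I : finType) (v : V) (w : I -> W) :
  v \ox (\sum_i w i) = \sum_i v \ox w i.
Proof.
by elim/big_rec2: _ => [|i x y _ <-]; rewrite ?tpure0r // tpureDr.
Qed.

Definition tcoefr V W j : 'Hom(tensor V W, V) :=
  tlift (fun v w => v2r w 0 j *: v).

Definition tcoefl V W i : 'Hom(tensor V W, W) :=
  tlift (fun v w => v2r v 0 i *: w).

Lemma tcoefrE V W j (v : V) (w : W) : tcoefr V j (v \ox w) = v2r w 0 j *: v.
Proof.
rewrite tliftE //; split=> [w' | v'] c x y; last first.
  by rewrite linearP !mxE scalerDl scalerA.
by rewrite scalerDr !scalerA mulrC.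
Qed.

Lemma tcoeflE V W i (v : V) (w : W) : tcoefl W i (v \ox w) = v2r v 0 i *: w.
Proof.
rewrite tliftE //; split=> [w' | v'] c x y.
  by rewrite linearP !mxE scalerDl scalerA.
by rewrite scalerDr !scalerA mulrC.
Qed.

Lemma tcoefr_sum V W (t : tensor V W) : t = \sum_j tcoefr V j t \ox tbasis j.
Proof.
elim/tensor_ind: t => [s t es et | v w].
  rewrite {1}es {1}et -big_split; apply: eq_bigr => j _ /=.
  by rewrite linearD tpureDl.
rewrite {1}[w]tbasis_sum tpure_sumr; apply: eq_bigr => j _.
by rewrite tcoefrE tpureZl tpureZr.
Qed.

Lemma tcoefl_sum V W (t : tensor V W) : t = \sum_i tbasis i \ox tcoefl W i t.
Proof.
elim/tensor_ind: t => [s t es et | v w].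
  rewrite {1}es {1}et -big_split; apply: eq_bigr => j _ /=.
  by rewrite linearD tpureDr.
rewrite {1}[v]tbasis_sum tpure_suml; apply: eq_bigr => j _.
by rewrite tcoeflE tpureZl tpureZr.
Qed.

Lemma tcoefl_tmap V W W' (f : 'Hom(W, W')) (i : 'I_(dim V)) t :
  tcoefl W' i (tmap \1%VF f t) = f (tcoefl W i t).
Proof.
elim/tensor_ind: t => [s t es et | v w]; first by rewrite !linearD /= es et.
by rewrite tmapE !tcoeflE id_lfunE linearZ.
Qed.

Lemma tcoefr_assoc U V W j (s : tensor U V) (w : W) :
  tmap \1%VF (tcoefr V j) (tassoc U V W (s \ox w)) = v2r w 0 j *: s.
Proof.
elim/tensor_ind: s => [s t es et | u v].
  by rewrite tpureDl !linearD /= es et.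
by rewrite tassocE tmapE tcoefrE id_lfunE tpureZr.
Qed.

(** Elements of V (x) W^* regarded as linear maps W -> V. *)
Definition teval V W (w : W) : 'Hom(tensor V 'Hom(W, K^o), V) :=
  tlift (fun v (phi : 'Hom(W, K^o)) => (phi w : K) *: v).

Lemma tevalE V W (w : W) (v : V) (phi : 'Hom(W, K^o)) :
  teval V w (v \ox phi) = (phi w : K) *: v.
Proof.
rewrite tliftE //; split=> [w' | v'] c x y.
  by rewrite scalerDr !scalerA mulrC.
by rewrite add_lfunE scale_lfunE scalerDl scalerA.
Qed.

Lemma teval_sum V W (t : tensor V 'Hom(W, K^o)) :
  t = \sum_i teval V (tbasis i) t \ox dbasis i.
Proof.
elim/tensor_ind: t => [s t es et | v phi].
  rewrite {1}es {1}et -big_split; apply: eq_bigr => j _ /=.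
  by rewrite linearD tpureDl.
rewrite {1}[phi]dbasis_sum tpure_sumr; apply: eq_bigr => j _.
by rewrite tevalE tpureZl tpureZr.
Qed.

End TensorCoordinates.

(** * Coefficient matrices of comodules *)

Section Comatrix.
Variables (K : fieldType) (H : hopfAlgebra K).

(** Equivalently, the matrices of the comodule structures on the vector space
    with basis I. *)
Definition comatrix (I : finType) (c : I -> I -> H) : Prop :=
  (forall i j, comul H (c i j) = \sum_k c i k \ox c k j) /\
  (forall i j, (counit H (c i j) : K) = (i == j)%:R).

Local Notation S := (antipode H).

Lemma antipodel_sum (I : finType) (x y : I -> H) h :
  comul H h = \sum_k x k \ox y k ->
  \sum_k S (x k) * y k = (counit H h : K) *: (1 : H).
Proof.
move=> hE; rewrite -antipodel hE linear_sum /=; apply: eq_bigr => k _.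
rewrite tliftE //; split=> [b | a] c u v; rewrite ?linearP.
  by rewrite mulrDl -fscalerAl.
by rewrite mulrDr -fscalerAr.
Qed.

Lemma antipoder_sum (I : finType) (x y : I -> H) h :
  comul H h = \sum_k x k \ox y k ->
  \sum_k x k * S (y k) = (counit H h : K) *: (1 : H).
Proof.
move=> hE; rewrite -antipoder hE linear_sum /=; apply: eq_bigr => k _.
rewrite tliftE //; split=> [b | a] c u v; rewrite ?linearP.
  by rewrite mulrDl -fscalerAl.
by rewrite mulrDr -fscalerAr.
Qed.

Lemma comatrix_antipodel (I : finType) (c : I -> I -> H) i j : comatrix c ->
  \sum_k S (c i k) * c k j = (i == j)%:R *: (1 : H).
Proof. by case=> cD ce; rewrite (antipodel_sum (cD i j)) ce. Qed.

Lemma comatrix_antipoder (I : finType) (c : I -> I -> H) i j : comatrix c ->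
  \sum_k c i k * S (c k j) = (i == j)%:R *: (1 : H).
Proof. by case=> cD ce; rewrite (antipoder_sum (cD i j)) ce. Qed.

Lemma sum_delta (V : lmodType K) (I : finType) (j : I) (x : I -> V) :
  \sum_i (i == j)%:R *: x i = x j.
Proof.
rewrite (bigD1 j) //= eqxx scale1r big1 ?addr0 // => i /negPf->.
by rewrite scale0r.
Qed.

Lemma scaler1_mul (c : K) (x : H) : (c *: (1 : H)) * x = c *: x.
Proof. by rewrite -fscalerAl mul1r. Qed.

Lemma mul_scaler1 (c : K) (x : H) : x * (c *: (1 : H)) = c *: x.
Proof. by rewrite -fscalerAr mulr1. Qed.

(** S(c) is a left inverse of the matrix c, hence equal to any right inverse. *)
Lemma comatrix_inv_uniq (I : finType) (c X : I -> I -> H) : comatrix c ->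
  (forall i j, \sum_k c i k * X k j = (i == j)%:R *: (1 : H)) ->
  forall i j, S (c i j) = X i j.
Proof.
move=> cc cX i j.
transitivity (\sum_l (\sum_k S (c i k) * c k l) * X l j); last first.
  rewrite -(sum_delta i (X^~ j)); apply: eq_bigr => l _.
  by rewrite comatrix_antipodel // scaler1_mul eq_sym.
transitivity (\sum_k S (c i k) * (\sum_l c k l * X l j)).
  rewrite -(sum_delta j (fun k => S (c i k))); apply: eq_bigr => k _.
  by rewrite cX mul_scaler1.
under eq_bigr do rewrite mulr_sumr.
rewrite exchange_big; apply: eq_bigr => l _; rewrite mulr_suml.
by apply: eq_bigr => k _; rewrite mulrA.
Qed.

Lemma comatrix_prod (I J : finType) (c : I -> I -> H) (d : J -> J -> H) :
  comatrix c -> comatrix d ->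
  comatrix (fun (u v : I * J) => c u.1 v.1 * d u.2 v.2).
Proof.
move=> [cD ce] [dD de]; split=> -[i k] [j l] /=.
  rewrite (comul_morph H).2 cD dD mulr_suml -(pair_bigA _ (fun x y =>
    (c i x * d k y) \ox (c x j * d y l))) /=; apply: eq_bigr => x _.
  by rewrite mulr_sumr; apply: eq_bigr => y _; rewrite tensor_mulE.
by rewrite (counit_morph H).2 /= ce de -natrM mulnb.
Qed.

(** Both sides are entries of a right inverse of the Kronecker product of c
    and d. *)
Lemma comatrix_antipodeM (I J : finType) (c : I -> I -> H) (d : J -> J -> H)
    i j k l : comatrix c -> comatrix d ->
  S (c i j * d k l) = S (d k l) * S (c i j).
Proof.
move=> cc dc.
apply: (comatrix_inv_uniq (c := fun u v : I * J => c u.1 v.1 * d u.2 v.2)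
  (X := fun u v => S (d u.2 v.2) * S (c u.1 v.1))
  (comatrix_prod cc dc) _ (i, k) (j, l)).
move=> {i j k l} [i k] [j l] /=.
rewrite -(pair_bigA _ (fun x y => c i x * d k y * (S (d y l) * S (c x j)))) /=.
transitivity (\sum_x (k == l)%:R *: (c i x * S (c x j))).
  apply: eq_bigr => x _.
  transitivity (c i x * (\sum_y d k y * S (d y l)) * S (c x j)).
    by rewrite mulr_sumr mulr_suml; apply: eq_bigr => y _; rewrite !mulrA.
  by rewrite comatrix_antipoder // mul_scaler1 fscalerAl.
by rewrite -scaler_sumr comatrix_antipoder // scalerA -natrM mulnb andbC.
Qed.

Lemma comatrix_counit_antipode (I : finType) (c : I -> I -> H) i j :
  comatrix c -> (counit H (S (c i j)) : K) = (i == j)%:R.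
Proof.
move=> cc; have := congr1 (counit H) (comatrix_antipoder i j cc).
rewrite linearZ /= (counit_morph H).1 linear_sum /=.
under eq_bigr do rewrite (counit_morph H).2 /= cc.2 eq_sym.
rewrite (sum_delta i (fun k => counit H (S (c k j)))) => ->.
by rewrite /GRing.scale /= mulr1.
Qed.

Section Coefficients.
Variable L : comodAlgebra H.

(** The coaction in coordinates: x |-> sum_j coef_j(x) (x) e_j. *)
Definition coef j : 'Hom(L, H) := (tcoefr H j \o coact L)%VF.

Lemma coefE j x : coef j x = tcoefr H j (coact L x).
Proof. exact: comp_lfunE. Qed.

Lemma coactE x : coact L x = \sum_j coef j x \ox tbasis j.
Proof.
by rewrite [LHS]tcoefr_sum; apply: eq_bigr => j _; rewrite coefE.
Qed.

Lemma comul_coef j x :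
  comul H (coef j x) = \sum_k coef k x \ox coef j (tbasis k).
Proof.
have := congr1 (tmap \1%VF (tcoefr H j)) (coact_coassoc x).
rewrite {1 2}coactE !linear_sum /=; set s := \sum_i _ => sE.
have -> : comul H (coef j x) = s.
  rewrite /s -(sum_delta j (fun i => comul H (coef i x))).
  apply: eq_bigr => i _; rewrite tmapE id_lfunE tcoefr_assoc v2r_tbasis.
  by rewrite eq_sym.
rewrite sE; apply: eq_bigr => i _.
by rewrite !tmapE !id_lfunE -coefE.
Qed.

Lemma counit_coef j x : (counit H (coef j x) : K) = v2r x 0 j.
Proof.
rewrite -[in RHS](coact_counit x) coactE !linear_sum summxE.
rewrite -[LHS]mul1r (bigD1 j) //= big1 => [|i ij].
  rewrite addr0 tliftE; first by rewrite linearZ mxE v2r_tbasis eqxx mulrC.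
  split=> [w' | v'] c u v; last by rewrite scalerDr !scalerA mulrC.
  by rewrite linearP scalerDl scalerA.
rewrite tliftE; first by rewrite linearZ mxE v2r_tbasis eq_sym (negPf ij) mulr0.
split=> [w' | v'] c u v; last by rewrite scalerDr !scalerA mulrC.
by rewrite linearP scalerDl scalerA.
Qed.

Lemma coef_comatrix : comatrix (fun i j => coef j (tbasis i)).
Proof.
split=> i j; first exact: comul_coef.
by rewrite counit_coef v2r_tbasis eq_sym.
Qed.

Lemma coef_antipoder j x :
  \sum_k coef k x * S (coef j (tbasis k)) = v2r x 0 j *: (1 : H).
Proof. by rewrite (antipoder_sum (comul_coef j x)) counit_coef. Qed.

End Coefficients.

(** Applied to H itself, the coefficient matrix has entries that span H, which
    extends statements about entries of such matrices to all of H. *)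
Definition regcomod : comodAlgebra H :=
  ComodAlgebra (comul_morph H) (@comul_coassoc _ H) (@comul_counitl _ H).

Lemma comatrix_span (x : H) :
  x = \sum_j (counit H (tbasis j) : K) *: coef (L := regcomod) j x.
Proof.
rewrite -[LHS]comul_counitr -[comul H x]/(coact regcomod x) coactE.
rewrite linear_sum /=.
apply: eq_bigr => j _; rewrite tliftE //.
split=> [w' | v'] c u v; first by rewrite scalerDr !scalerA mulrC.
by rewrite linearP scalerDl scalerA.
Qed.

Lemma comatrix_ind (Q : H -> Prop) :
    (forall c y z, Q y -> Q z -> Q (c *: y + z)) -> Q 0 ->
    (forall i j, Q (coef (L := regcomod) j (tbasis i))) -> forall x, Q x.
Proof.
move=> Qlin Q0 Qc x.
have Qsum (I : finType) (a : I -> K) (y : I -> H) :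
    (forall i, Q (y i)) -> Q (\sum_i a i *: y i).
  by move=> Qy; elim/big_rec: _ => // i z _; apply: Qlin.
rewrite [x]tbasis_sum; apply: (Qsum) => i.
by rewrite [tbasis i]comatrix_span; apply: (Qsum) => j.
Qed.

Lemma antipodeM (x y : H) : S (x * y) = S y * S x.
Proof.
have cc := coef_comatrix regcomod.
elim/comatrix_ind: x => [c x x' ex ex' | | i j].
- by rewrite mulrDl -fscalerAl !linearP /= ex ex' mulrDr -fscalerAr.
- by rewrite mul0r !linear0 mulr0.
elim/comatrix_ind: y => [c y y' ey ey' | | k l].
- by rewrite mulrDr -fscalerAr !linearP /= ey ey' mulrDl -fscalerAl.
- by rewrite mulr0 !linear0 mul0r.
exact: (comatrix_antipodeM _ _ _ _ cc cc).
Qed.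

Lemma antipode1 : S 1 = 1.
Proof.
have := @antipodel _ H 1; rewrite (comul_morph H).1 tensor_oneE tliftE.
  by rewrite mulr1 (counit_morph H).1 scale1r.
split=> [b | a] c u v; rewrite ?linearP.
  by rewrite mulrDl -fscalerAl.
by rewrite mulrDr -fscalerAr.
Qed.

End Comatrix.

(** * The functor H (x) - on modules over a comodule algebra *)

Section Projective.
Variables (K : fieldType) (A : finAlgType K).

Lemma regmod_projective : projective (regmod A).
Proof.
move=> M N g f gh gS fh; have [m mE] := gS (f (1 : A)).
exists (orbit m) => [|a]; first exact: orbit_hom.
by rewrite orbitE gh mE -fh regmodE mulr1.
Qed.

Lemma projective_retract (P Q : finModule A) (s : 'Hom(Q, P)) (r : 'Hom(P, Q)) :
  module_hom s -> module_hom r -> (forall x, r (s x) = x) ->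
  projective P -> projective Q.
Proof.
move=> sh rh rs Pp M N g f gh gS fh.
have [h hh hE] := Pp M N g (f \o r)%VF gh gS (hom_comp rh fh).
exists (h \o s)%VF => [|x]; first exact: hom_comp.
by rewrite comp_lfunE hE comp_lfunE rs.
Qed.

End Projective.

Section ComoduleAlgebra.
Variables (K : fieldType) (H : hopfAlgebra K) (L : comodAlgebra H).
Local Notation S := (antipode H).
Local Notation D := (dualmod L).
Local Notation F := (mod_tensor (regmod H)).
Local Notation "'c_' i j" := (coef (L := L) j (tbasis i))
  (at level 10, i at level 8, j at level 8).

Lemma mod_tensorE (X : finModule H) (M : finModule L) a (x : X) (m : M) :
  act (mod_tensor X M) a (x \ox m) =
  \sum_l act X (coef l a) x \ox act M (tbasis l) m.
Proof.
rewrite [act _ _]comp_lfunE coactE linear_sum sum_lfunE.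
by apply: eq_bigr => l _; rewrite tact_pairE.
Qed.

Section Cover.
Variable M : finModule L.

Definition cover : 'Hom(F M, M) :=
  tlift (fun (x : H) (m : M) => (counit H x : K) *: m).

Lemma coverE (x : H) (m : M) : cover (x \ox m) = (counit H x : K) *: m.
Proof.
rewrite [LHS]tliftE //; split=> [w' | v'] c u v.
  by rewrite linearP scalerDl scalerA.
by rewrite scalerDr !scalerA mulrC.
Qed.

Lemma cover_hom : module_hom cover.
Proof.
move=> a; elim/tensor_ind=> [s t es et | x m].
  by rewrite !linearD /= es et.
rewrite mod_tensorE linear_sum coverE linearZ /= [a in RHS]tbasis_sum.
rewrite linear_sum sum_lfunE scaler_sumr; apply: eq_bigr => l _.
rewrite coverE regmodE (counit_morph H).2 linearZ scale_lfunE scalerA.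
by rewrite -counit_coef mulrC.
Qed.

Lemma cover_surj m : exists t, cover t = m.
Proof.
by exists ((1 : H) \ox m); rewrite coverE (counit_morph H).1 scale1r.
Qed.
End Cover.

(** As a map L -> H, the image of phi is b |-> S(b_(-1)) phi(b_(0)).
    It is L-linear for the diagonal action on H (x) L^* because S reverses
    products. *)
Definition twisted_coact : 'Hom(D, F D) :=
  linfun (fun phi : 'Hom(L, K^o) =>
    \sum_i (\sum_j (phi (tbasis j) : K) *: S (c_ i j)) \ox dbasis i).

Lemma twisted_coactE (phi : 'Hom(L, K^o)) :
  twisted_coact phi =
  \sum_i (\sum_j (phi (tbasis j) : K) *: S (c_ i j)) \ox dbasis i.
Proof.
rewrite linfunE // => c f g; rewrite scaler_sumr -big_split.
apply: eq_bigr => i _ /=; rewrite -tpureZl -tpureDl; congr (_ \ox _).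
rewrite scaler_sumr -big_split; apply: eq_bigr => j _ /=.
by rewrite add_lfunE scale_lfunE scalerDl scalerA.
Qed.

Lemma coef_sum j (x : L) : coef j x = \sum_i (v2r x 0 i : K) *: c_ i j.
Proof.
rewrite [x in LHS]tbasis_sum linear_sum; apply: eq_bigr => i _.
by rewrite linearZ.
Qed.

Lemma teval_twisted_coact (phi : 'Hom(L, K^o)) (x : L) :
  teval H x (twisted_coact phi) = \sum_j (phi (tbasis j) : K) *: S (coef j x).
Proof.
rewrite twisted_coactE linear_sum /=.
transitivity (\sum_i \sum_j
    (phi (tbasis j) : K) *: ((v2r x 0 i : K) *: S (c_ i j))).
  apply: eq_bigr => i _; rewrite tevalE dbasisE scaler_sumr.
  by apply: eq_bigr => j _; rewrite !scalerA mulrC.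
rewrite exchange_big; apply: eq_bigr => j _ /=; rewrite -scaler_sumr.
congr (_ *: _); rewrite coef_sum linear_sum; apply: eq_bigr => i _.
by rewrite linearZ.
Qed.

Lemma teval_twisted_coactM (phi : 'Hom(L, K^o)) (x y : L) :
  teval H (x * y) (twisted_coact phi) = \sum_p \sum_q
    (phi ((tbasis p : L) * (tbasis q : L)) : K) *:
    (S (coef q y) * S (coef p x)).
Proof.
have bl : bilinear_map (fun (h : H) (z : L) => (phi z : K) *: S h).
  split=> [w' | v'] c u v; first by rewrite linearP scalerDr !scalerA mulrC.
  by rewrite linearP scalerDl scalerA.
have E (z : L) : teval H z (twisted_coact phi) =
    tlift (fun (h : H) (z : L) => (phi z : K) *: S h) (coact L z).
  rewrite teval_twisted_coact coactE linear_sum; apply: eq_bigr => j _.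
  by rewrite /= tliftE.
rewrite E (coact_morph L).2 !coactE mulr_suml linear_sum.
apply: eq_bigr => p _; rewrite mulr_sumr linear_sum; apply: eq_bigr => q _.
by rewrite /= tensor_mulE tliftE // antipodeM.
Qed.

(** On H (x) L^* = Hom(L, H) the action is (a f)(x) = a_(-1) f(x a_(0)). *)
Lemma teval_act a (t : F D) (x : L) :
  teval H x (act (F D) a t) =
  \sum_l coef l a * teval H (x * tbasis l) t.
Proof.
elim/tensor_ind: t => [s t es et | h phi].
  rewrite !linearD /= es et -big_split; apply: eq_bigr => l _ /=.
  by rewrite linearD mulrDr.
rewrite mod_tensorE linear_sum; apply: eq_bigr => l _ /=.
by rewrite !tevalE dualmodE regmodE -fscalerAr.
Qed.

(** The computation is a_(-2) S(a_(-1)) S(x_(-1)) phi(x_(0) a_(0))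
    = S(x_(-1)) phi(x_(0) a). *)
Lemma twisted_coact_hom : module_hom twisted_coact.
Proof.
move=> a phi; rewrite [LHS]teval_sum [RHS]teval_sum; apply: eq_bigr => i _.
congr (_ \ox _); set x := tbasis i.
rewrite teval_twisted_coact teval_act.
transitivity (\sum_p \sum_q (phi ((tbasis p : L) * (tbasis q : L)) : K) *:
    ((v2r a 0 q : K) *: S (coef p x))).
  apply: eq_bigr => p _; rewrite dualmodE [a in LHS]tbasis_sum mulr_sumr.
  rewrite linear_sum scaler_suml; apply: eq_bigr => q _.
  by rewrite -fscalerAr linearZ /= scalerA mulrC.
under [RHS]eq_bigr do rewrite teval_twisted_coactM mulr_sumr.
rewrite [RHS]exchange_big; apply: eq_bigr => p _ /=.
under [RHS]eq_bigr do rewrite mulr_sumr.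
rewrite [RHS]exchange_big; apply: eq_bigr => q _ /=.
under [RHS]eq_bigr do rewrite -fscalerAr mulrA.
by rewrite -scaler_sumr -mulr_suml coef_antipoder scaler1_mul.
Qed.

Lemma cover_twisted_coact phi : cover D (twisted_coact phi) = phi.
Proof.
rewrite twisted_coactE linear_sum [RHS]dbasis_sum; apply: eq_bigr => i _ /=.
rewrite (@coverE D _ (dbasis i)) linear_sum; congr (_ *: _).
rewrite (bigD1 i) //= big1 ?addr0 => [|j /negPf ij]; rewrite linearZ /=.
  rewrite (comatrix_counit_antipode _ _ (coef_comatrix L)) eqxx.
  by rewrite /GRing.scale /= mulr1.
rewrite (comatrix_counit_antipode _ _ (coef_comatrix L)) eq_sym ij.
by rewrite /GRing.scale /= mulr0.
Qed.

Lemma dual_projective : projective (F D) -> projective D.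
Proof.
exact: projective_retract twisted_coact_hom (@cover_hom D) cover_twisted_coact.
Qed.

Definition lmul (a : H) : 'End(H) := linfun (fun x : H => a * x).

Lemma lmulE a x : lmul a x = a * x.
Proof. by rewrite linfunE //; apply: (@mul_bilinear K H).2. Qed.

(** Right multiplication on the factor H commutes with the left action. *)
Lemma rmul_hom (D' M : finModule L) (h : H) (T : 'Hom(D', M)) :
  module_hom T -> @module_hom _ _ (F D') (F M) (tmap (rmul h) T).
Proof.
move=> Th a; elim/tensor_ind=> [s t es et | x m].
  by rewrite !linearD /= es et.
rewrite mod_tensorE linear_sum /= tmapE (@mod_tensorE (regmod H) M).
apply: eq_bigr => l _.
by rewrite tmapE !regmodE !rmulE mulrA Th.
Qed.

(** S^2(b_(2)) S(b_(1)) = S(b_(1) S(b_(2))) = eps(b), for matrix entries b. *)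
Lemma antipode2_inv (j k : 'I_(dim L)) :
  \sum_i S (S (c_ i j)) * S (c_ k i) = (k == j)%:R *: (1 : H).
Proof.
under eq_bigr do rewrite -antipodeM.
rewrite -linear_sum (comatrix_antipoder _ _ (coef_comatrix L)) linearZ.
by rewrite /= antipode1.
Qed.

(** The maps b h T below are L-linear and depend injectively on the tensor
    h (x) T: applying Lam j to b h T gives back h (x) T(d_j), where d is the
    dual basis. *)
Lemma hdim_tensor_ge (M : finModule L) :
  (dim H * hdim D M <= hdim D (F M))%N.
Proof.
pose U := subvs_of (homs D M).
pose b (h : H) (T : U) : 'Hom(D, F M) :=
  (tmap (rmul h) (vsval T) \o twisted_coact)%VF.
have bE h T phi : b h T phi = tmap (rmul h) (vsval T) (twisted_coact phi).
  exact: comp_lfunE.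
have bb : bilinear_map b.
  have [tl tr] := @tmap_bilinear K H D H M.
  have [ml mr] := @mul_bilinear K H.
  split=> [T | h] c x y.
    have rl : rmul (c *: x + y) = c *: rmul x + rmul y.
      by apply/lfunP=> z; rewrite add_lfunE scale_lfunE !rmulE mr.
    by rewrite /b /= rl tl (comp_lfun_bilinear _ _ _).1.
  by rewrite /b linearP tr (comp_lfun_bilinear _ _ _).1.
pose Theta : 'Hom(tensor H U, 'Hom(D, F M)) := tlift b.
pose ev j : 'Hom(U, M) := linfun (fun T : U => vsval T (dbasis j)).
have evE j T : ev j T = vsval T (dbasis j).
  by rewrite linfunE // => c x y; rewrite linearP add_lfunE scale_lfunE.
pose Lam j : 'Hom('Hom(D, F M), F M) := linfun (fun z : 'Hom(D, F M) =>
  \sum_i tmap (lmul (S (S (c_ i j)))) \1%VF (z (dbasis i))).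
have LamE j z : Lam j z =
    \sum_i tmap (lmul (S (S (c_ i j)))) \1%VF (z (dbasis i)).
  rewrite linfunE // => c x y; rewrite scaler_sumr -big_split.
  by apply: eq_bigr => i _ /=; rewrite add_lfunE scale_lfunE linearP.
have tc_dbasis i : twisted_coact (dbasis i) = \sum_k S (c_ k i) \ox dbasis k.
  rewrite twisted_coactE; apply: eq_bigr => k _; congr (_ \ox _).
  rewrite (bigD1 i) //= dbasisE v2r_tbasis eqxx scale1r big1 ?addr0 // => j ij.
  by rewrite dbasisE v2r_tbasis eq_sym (negPf ij) scale0r.
have LamTheta j t : Lam j (Theta t) = tmap \1%VF (ev j) t.
  elim/tensor_ind: t => [s t es et | h T]; first by rewrite !linearD /= es et.
  rewrite tmapE id_lfunE evE /Theta tliftE // LamE.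
  transitivity (\sum_k (k == j)%:R *: (h \ox vsval T (dbasis k))); last first.
    by rewrite sum_delta.
  transitivity (\sum_i \sum_k
      (S (S (c_ i j)) * S (c_ k i) * h) \ox vsval T (dbasis k)).
    apply: eq_bigr => i _. rewrite bE tc_dbasis !linear_sum.
    by apply: eq_bigr => k _; rewrite /= !tmapE lmulE rmulE id_lfunE mulrA.
  rewrite exchange_big; apply: eq_bigr => k _ /=.
  by rewrite -tpure_suml -mulr_suml antipode2_inv scaler1_mul tpureZl.
have ThetaI : injective Theta.
  move=> t t' /eqP; rewrite -subr_eq0 -linearB => /eqP Th0.
  apply/eqP; rewrite -subr_eq0; apply/eqP; move: (t - t') Th0 => {t'}t Th0.
  rewrite [t]tcoefl_sum big1 // => i _; suff -> : tcoefl U i t = 0.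
    exact: tpure0r.
  apply: subvs_inj; apply/lfunP=> phi; rewrite linear0 zero_lfunE.
  rewrite [phi]dbasis_sum linear_sum big1 // => j _; rewrite linearZ /=.
  by rewrite -evE -tcoefl_tmap -LamTheta Th0 !(linear0, scaler0).
have imgT : (limg Theta <= homs D (F M))%VS.
  apply/subvP=> _ /memv_imgP[t _ ->]; elim/tensor_ind: t => [s t es et | h T].
    by rewrite linearD memvD.
  rewrite /Theta tliftE //; apply/homsP.
  apply: (@hom_comp _ _ D (F D) (F M) twisted_coact).
    exact: twisted_coact_hom.
  by apply: rmul_hom; apply/homsP/subvsP.
by have := dimvS imgT; rewrite dim_limg_inj // dimvf dim_tensor.
Qed.

End ComoduleAlgebra.

Theorem lemma4p5 (k : fieldType) (H : hopfAlgebra k) (L : comodAlgebra H)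
    (hL : exact_comodAlgebra L) : frobenius_algebra L.
Proof.
have FP M : projective (mod_tensor (L := L) (regmod H) M).
  by apply: hL; apply: regmod_projective.
apply: (@frobenius_criterion _ _ (mod_tensor (regmod H)) (dim H)) => // M.
- by exists (cover M); [apply: cover_hom | apply: cover_surj].
- exact: hdim_tensor_ge.
- exact: dual_projective.
Qed.
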